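(* Let $k\in\mathbb N$ and let $\mathcal K$ be a proper missing-digit fractal in $[0,1]^k$ whose Cantor--Lebesgue measure $\mu$ satisfies \[ \dim_{\ell^1}(\mu)>k-\frac{k}{k+1}. \] Then there exists a constant $\eta>0$ such that for every $c>0$ there are $Q_0\geqslant1$ and constants $0<C_1\leqslant C_2$ (depending on $\mathcal K$ and $c$) with \[ C_1\,\delta^{k-\dim_{\mathrm H}(\mathcal K)}Q^{\dim_{\mathrm H}(\mathcal K)+1}\leqslant \#\mathcal N_{\mathcal K}(Q,\delta)\leqslant C_2\,\delta^{k-\dim_{\mathrm H}(\mathcal K)}Q^{\dim_{\mathrm H}(\mathcal K)+1} \] for all $Q\geqslant Q_0$ and all $\delta\in(0,1)$ with $\delta\geqslant cQ^{-\eta-1/k}$.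
   Context: A missing-digit fractal is a set $\mathcal K_{b,\mathcal D}=\{\sum_{j\geqslant1}\mathbf d^{(j)}b^{-j}:\mathbf d^{(j)}\in\mathcal D\}\subseteq[0,1]^k$ with integers $b\geqslant2$ and nonempty $\mathcal D\subseteq\{0,1,\dots,b-1\}^k$; its Cantor--Lebesgue measure is the law of $\sum_{j\geqslant1}\mathbf d^{(j)}b^{-j}$ with $\mathbf d^{(j)}$ i.i.d. uniform on $\mathcal D$. It is proper if $\#\mathcal K\geqslant2$ and $\mathcal K\neq[0,1]^k$. $\dim_{\mathrm H}$ is Hausdorff dimension. For a Borel probability measure $\nu$ on $[0,1]^k$, $\hat\nu({\boldsymbol{\xi}})=\int e^{-2\pi i{\boldsymbol{\xi}}\cdot\mathbf x}\,d\nu(\mathbf x)$ and $\dim_{\ell^1}(\nu)=\sup\{s\geqslant0:\sum_{{\boldsymbol{\xi}}\in\mathbb Z^k,\|{\boldsymbol{\xi}}\|_\infty\leqslant Q}|\hat\nu({\boldsymbol{\xi}})|\ll Q^{k-s}\ (Q\geqslant1)\}$. For compact $\mathcal K\subset\mathbb R^k$, $Q\geqslant1$ and $\delta\geqslant0$, \[ \mathcal N_{\mathcal K}(Q,\delta)=\{(\mathbf a,q)\in\mathbb Z^k\times(\mathbb Z\cap[1,Q]):\ \mathrm{dist}(\mathbf a/q,\mathcal K)\leqslant\delta/Q\}. \] *)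

(* Defs.v *)
From HB Require Import structures.
From mathcomp Require Import all_boot all_order all_algebra.
From mathcomp Require Import all_classical all_reals all_analysis.
From mathcomp Require Import finmap.
Set Implicit Arguments. Unset Strict Implicit. Unset Printing Implicit Defensive.
Import Order.TTheory GRing.Theory Num.Theory.
Import numFieldNormedType.Exports.
Local Open Scope classical_set_scope.
Local Open Scope ring_scope.

Section MissingDigit.
Variable R : realType.

Definition supdist (k : nat) (x y : 'I_k -> R) : R :=
  \big[Num.max/0]_(i < k) `|x i - y i|.

Definition setdist (k : nat) (x : 'I_k -> R) (A : set ('I_k -> R)) : R :=
  inf [set supdist x y | y in A].

Definition digit (k b : nat) := {ffun 'I_k -> 'I_b}.

(* sum_{j >= 1} d^(j) b^{-j}, the digit sequence d indexed from 0 *)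
Definition digsum (k b : nat) (d : nat -> digit k b) : 'I_k -> R :=
  fun i => limn (fun n => \sum_(j < n) ((d j i : nat)%:R * (b%:R ^- j.+1) : R)).

Definition missing_digit_fractal (k b : nat) (D : {set digit k b})
  : set ('I_k -> R) :=
  [set x | exists d : nat -> digit k b, (forall j, d j \in D) /\ x = digsum d].

Definition unit_cube (k : nat) : set ('I_k -> R) :=
  [set x | forall i, 0 <= x i <= 1].

Definition proper_fractal (k : nat) (K : set ('I_k -> R)) : Prop :=
  (exists x y, K x /\ K y /\ x <> y) /\ K <> @unit_cube k.

Definition iid_uniform_digits (dsp : measure_display) (Omega : measurableType dsp)
  (P : probability Omega R) (k b : nat) (D : {set digit k b})
  (d : nat -> Omega -> digit k b) : Prop :=
  (forall j (a : digit k b), measurable [set w | d j w = a]) /\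
  (forall j (a : digit k b),
      P [set w | d j w = a] = (if a \in D then (#|D|%:R^-1)%:E else 0%E)) /\
  (forall (J : seq nat) (a : nat -> digit k b), uniq J ->
      P (\bigcap_(j in [set j | j \in J]) [set w | d j w = a j]) =
      (\prod_(j <- J) P [set w | d j w = a j])%E).

(* The random point X = sum_j d^(j) b^{-j}; its law is the Cantor--Lebesgue
   measure mu.  Fourier coefficient mu^(xi) = E[exp(-2 pi i xi.X)], returned
   through its real and imaginary parts; we only need its modulus. *)
Definition CL_point (dsp : measure_display) (Omega : measurableType dsp)
  (k b : nat) (d : nat -> Omega -> digit k b) (w : Omega) : 'I_k -> R :=
  digsum (fun j => d j w).

Definition dotZ (k : nat) (xi : 'I_k -> int) (x : 'I_k -> R) : R :=
  \sum_(i < k) (xi i)%:~R * x i.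

Definition fourier_abs (dsp : measure_display) (Omega : measurableType dsp)
  (P : probability Omega R) (k b : nat) (d : nat -> Omega -> digit k b)
  (xi : 'I_k -> int) : R :=
  let re := Rintegral P setT
      (fun w => cos (2 * pi * dotZ xi (CL_point d w))) in
  let im := Rintegral P setT
      (fun w => - sin (2 * pi * dotZ xi (CL_point d w))) in
  Num.sqrt (re ^+ 2 + im ^+ 2).

(* sum over xi in Z^k with ||xi||_oo <= Q, i.e. |xi_i| <= M := floor Q *)
Definition box_sum (k : nat) (Q : R) (F : ('I_k -> int) -> R) : R :=
  let M := `|Num.floor Q|%N in
  \sum_(t : {ffun 'I_k -> 'I_(M.*2.+1)})
     F (fun i => (t i : nat)%:Z - M%:Z).

(* the l^1 dimension of a measure given by the modulus of its Fourier
   coefficients on Z^k *)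
Definition dim_l1 (k : nat) (fabs : ('I_k -> int) -> R) : R :=
  sup [set s : R | 0 <= s /\
        exists C : R, forall Q : R, 1 <= Q ->
          box_sum Q fabs <= C * Q `^ (k%:R - s)].

Definition diam (k : nat) (U : set ('I_k -> R)) : \bar R :=
  ereal_sup [set (supdist x y)%:E | x in U & y in U].

Definition cover_term (k : nat) (s : R) (U : set ('I_k -> R)) : \bar R :=
  if U == set0 then 0%E else ((fine (diam U)) `^ s)%:E.

Definition hausdorff_content (k : nat) (s delta : R) (A : set ('I_k -> R))
  : \bar R :=
  ereal_inf [set (\sum_(i <oo) cover_term s (U i))%E |
    U in [set U : nat -> set ('I_k -> R) |
          A `<=` \bigcup_i U i /\ forall i, (diam (U i) <= delta%:E)%E]].

Definition hausdorff_measure (k : nat) (s : R) (A : set ('I_k -> R)) : \bar R :=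
  ereal_sup [set hausdorff_content s delta A | delta in [set delta : R | 0 < delta]].

Definition dimH (k : nat) (A : set ('I_k -> R)) : R :=
  inf [set s : R | 0 <= s /\ hausdorff_measure s A = 0%E].

Definition rat_points_near (k : nat) (K : set ('I_k -> R)) (Q delta : R)
  : set ({ffun 'I_k -> int} * int) :=
  [set aq : {ffun 'I_k -> int} * int | (1 <= aq.2)%R /\ (aq.2)%:~R <= Q /\
     setdist (fun i => (aq.1 i)%:~R / (aq.2)%:~R) K <= delta / Q].

Definition count_N (k : nat) (K : set ('I_k -> R)) (Q delta : R) : nat :=
  (#|` fset_set (rat_points_near K Q delta)|)%fset.

End MissingDigit.

(* Main.v *)
Require Import Defs.
From HB Require Import structures.
From mathcomp Require Import all_boot all_order all_algebra.
From mathcomp Require Import all_classical all_reals all_analysis.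
From mathcomp Require Import measurable_realfun finmap complex ring lra zify.
Set Implicit Arguments. Unset Strict Implicit. Unset Printing Implicit Defensive.
Import Order.TTheory GRing.Theory Num.Theory.
Import numFieldNormedType.Exports.
Local Open Scope classical_set_scope.
Local Open Scope ring_scope.

(** Let [X] be the random point of the fractal and [kap = ln #D / ln b], which is
    the Hausdorff dimension by the mass distribution principle.  Cut at the level
    [n] with [b^-n ~ delta / Q]: up to constants, counting the rationals [a / q]
    near the fractal amounts to counting the pairs [(v, q)], [v] a word of [n]
    digits of [D], such that [q X] is within [~ delta] of [Z^k] on the cylinder of
    [v]; since that cylinder has probability [#D^-n], this number is
    [#D^n sum_q P (dist (q X, Z^k) <~ delta)] with [#D^n ~ (Q / delta)^kap].
    The indicator of [dist (y, Z^k) <~ delta] is bounded above and below by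
    trigonometric polynomials of degree [O (1 / delta)] with coefficients
    [O (delta^k)] and mean of the order of [delta^k], built from Jackson's kernel
    [F = |sum_(j < m) e (j y)|^4 / m^4].  The nonzero frequencies contribute at most
    [delta^k sum_(q <= Q) sum_(0 < |h| <~ 1 / delta) |mu^ (q h)|], which the divisor
    bound reduces to the l^1 sum over a box of side [Q / delta]; the hypothesis on
    [dim_l1] makes it [O (delta^k Q^(1 - c'))] with [c' > 0] in the stated range. *)

(** Origin of the range: when [1 / delta <~ Q^(eta + 1/k)], the box has side [<~ Q^(1 + 1/k + eta)],
    so an l^1 exponent [th < k / (k+1)] gives an error [Q^(th (1 + 1/k + eta))]. As
    [th (1 + 1/k) < 1], there is room below [Q], and [eta] is chosen to use half of it. The same
    strict inequality pays for the divisor bound, which loses an arbitrarily small power. Why a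
    fourth power: the majorant only needs a nonnegative kernel bounded below near the integers, but
    the minorant subtracts multiples of [F (1 - cos) / (4 e^2)] with [e ~ delta]. For Fejer's kernel
    the mean of [F (1 - cos)] is [m^-2] against [m^-1] for [F], which would force [m ~ delta^-2].
    For Jackson's kernel it is [m^-3], and [m ~ 1 / delta] is enough. The two counts are not
    symmetric in [q]: near [a / q] the condition reads [|a - q x| <= q delta / Q], which shrinks for
    small [q]. The lower bound therefore keeps only [q >= Q / 2], at the cost of a constant. *)

Section TrigPoly.
Variable R : realType.
Local Open Scope complex_scope.

(** * Trigonometric polynomials and the Dirichlet kernel *)

Definition cexp2pi (t : R) : R[i] := cos (2 * pi * t) +i* sin (2 * pi * t).

Lemma cexp2piD s t : cexp2pi (s + t) = cexp2pi s * cexp2pi t.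
Proof. by rewrite /cexp2pi mulrDr cosD sinD; simpc; congr (_ +i* _); ring. Qed.

Lemma cexp2pi0 : cexp2pi 0 = 1.
Proof. by rewrite /cexp2pi mulr0 cos0 sin0. Qed.

Lemma cexp2pi_sum (I : finType) (f : I -> R) : cexp2pi (\sum_i f i) = \prod_i cexp2pi (f i).
Proof. by apply: (big_morph cexp2pi cexp2piD cexp2pi0). Qed.

Lemma cos_period_int (x : R) (m : int) : cos (2 * pi * (x + m%:~R)) = cos (2 * pi * x).
Proof.
have H (n : nat) y : cos (2 * pi * (y + n%:R)) = cos (2 * pi * y) :> R.
  elim: n => [|n IH]; first by rewrite addr0.
  rewrite -[n.+1%:R]natr1 addrA mulrDr mulr1 -[RHS]IH.
  by rewrite [2 * pi]mulr_natl cosD2pi.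
case: m => n; first by rewrite -pmulrn H.
rewrite NegzE mulrNz -[RHS](H n.+1).
by rewrite -(H n.+1 (x + _)) -!pmulrn subrK H.
Qed.

(* [p] is a trigonometric polynomial of degree at most [N] with mean [a] and
   coefficients bounded by [B]. *)
Definition trig_repr (N : nat) (B a : R) (p : R -> R) : Prop :=
  exists c : int -> R, [/\ c 0 = a, forall h, `|c h| <= B &
    forall y, (p y)%:C = \sum_(t < N.*2.+1)
       (c (t%:Z - N%:Z))%:C * cexp2pi ((t%:Z - N%:Z)%:~R * y)].

(** Kernels come as sums over index tuples in which a frequency occurs many times; the coefficient
    at [h] is the total weight of the fiber of [f] over [h]. Absolute values in the bound allow for
    the signed weights of the defect kernel. *)
Lemma trig_repr_sum (T : finType) (f : T -> int) (w : T -> R) (N : nat) (B : R) p :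
  (forall t, (`|f t| <= N)%N) ->
  (forall h, \sum_(t | f t == h) `|w t| <= B) ->
  (forall y, (p y)%:C = \sum_t (w t)%:C * cexp2pi ((f t)%:~R * y)) ->
  trig_repr N B (\sum_(t | f t == 0) w t) p.
Proof.
move=> fN wB pE; exists (fun h => \sum_(t | f t == h) w t); split => //.
  by move=> h; apply: le_trans (wB h); exact: ler_norm_sum.
move=> y; rewrite pE.
have g t : (absz (f t + N%:Z)%R < N.*2.+1)%N by move: (fN t); lia.
rewrite (partition_big (fun t => Ordinal (g t)) xpredT) //=.
apply: eq_bigr => u _; rewrite rmorph_sum /= mulr_suml.
have E t : (Ordinal (g t) == u) = (f t == u%:Z - N%:Z).
  by rewrite -val_eqE /=; move: (fN t); lia.
rewrite (eq_bigl _ _ E); apply: eq_bigr => t /eqP -> //.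
Qed.

(** The squared modulus of [sum_(j < n) e (j y)], that is [n] times Fejer's kernel, written with
    real and imaginary parts. *)
Definition dirichlet_sq (n : nat) (y : R) : R :=
  (\sum_(j < n) cos (2 * pi * (j%:R * y))) ^+ 2 +
  (\sum_(j < n) sin (2 * pi * (j%:R * y))) ^+ 2.

Lemma dirichlet_sqE n y : dirichlet_sq n y =
  \sum_(t : 'I_n * 'I_n) cos (2 * pi * ((t.1%:Z - t.2%:Z)%:~R * y)).
Proof.
rewrite /dirichlet_sq !expr2 !big_distrlr /= -big_split /= -(pair_bigA _
  (fun j l : 'I_n => cos (2 * pi * ((j%:Z - l%:Z)%:~R * y)))) /=.
apply: eq_bigr => j _; rewrite -big_split /=; apply: eq_bigr => l _.
by rewrite -cosB; congr cos; rewrite rmorphB /= -!pmulrn; ring.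
Qed.

Lemma dirichlet_sq_le n y : dirichlet_sq n y <= n%:R ^+ 2.
Proof.
rewrite dirichlet_sqE (le_trans (ler_sum _ (fun t _ => cos_le1 _))) //.
by rewrite sumr_const card_prod !card_ord -natrX -mulnn.
Qed.

Lemma dirichlet_sq_ge0 n y : 0 <= dirichlet_sq n y.
Proof. by rewrite addr_ge0 ?sqr_ge0. Qed.

Lemma dirichlet_sq_complex n y : (dirichlet_sq n y)%:C =
  \sum_(t : 'I_n * 'I_n) cexp2pi ((t.1%:Z - t.2%:Z)%:~R * y).
Proof.
rewrite -(pair_bigA _ (fun j l : 'I_n => cexp2pi ((j%:Z - l%:Z)%:~R * y))) /=.
under eq_bigr do under eq_bigr do rewrite rmorphB /= -!pmulrn mulrBl cexp2piD.
rewrite -big_distrlr /=.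
have E1 : \sum_(j < n) cexp2pi (j%:R * y) =
   (\sum_(j < n) cos (2 * pi * (j%:R * y))) +i* (\sum_(j < n) sin (2 * pi * (j%:R * y))).
  by elim/big_rec3 : _ => //= j c s z _ ->; rewrite /cexp2pi; simpc.
have E2 : \sum_(j < n) cexp2pi (- (j%:R * y)) =
   (\sum_(j < n) cos (2 * pi * (j%:R * y))) +i* (- \sum_(j < n) sin (2 * pi * (j%:R * y))).
  elim/big_rec3 : _ => /= [|j c s z _ ->]; first by rewrite oppr0.
  by rewrite /cexp2pi mulrN cosN sinN; simpc; apply/eqP; rewrite eq_complex /=; apply/andP; split; apply/eqP; ring.
rewrite E1 E2 /dirichlet_sq; simpc; congr (_ +i* _); ring.
Qed.

(** This is the squared modulus of the geometric sum [(1 - e (y)) sum_(j < n) e (j y) = 1 - e (n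
    y)], since [|1 - e (t)|^2 = 2 (1 - cos (2 pi t))]. *)
Lemma dirichlet_sq_geom n y :
  dirichlet_sq n y * (1 - cos (2 * pi * y)) = 1 - cos (2 * pi * (n%:R * y)).
Proof.
pose C m : R := \sum_(j < m) cos (2 * pi * (j%:R * y)).
pose S m : R := \sum_(j < m) sin (2 * pi * (j%:R * y)).
pose c := cos (2 * pi * y); pose s := sin (2 * pi * y).
(* Real and imaginary parts of the telescoped geometric sum. *)
have H m : C m * (1 - c) + S m * s = 1 - cos (2 * pi * (m%:R * y)) /\
           S m * (1 - c) - C m * s = - sin (2 * pi * (m%:R * y)).
  elim: m => [|m [IH1 IH2]].
    by rewrite /C /S !big_ord0 !mul0r mulr0 cos0 sin0; split; ring.
  have E : 2 * pi * (m.+1%:R * y) = 2 * pi * (m%:R * y) + 2 * pi * y.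
    by rewrite -[m.+1%:R]natr1; ring.
  rewrite E cosD sinD -/c -/s /C /S !big_ord_recr /= -/(C m) -/(S m).
  set cm := cos _ in IH1 IH2 *; set sm := sin _ in IH1 IH2 *.
  split.
    have -> : (C m + cm) * (1 - c) + (S m + sm) * s =
      (C m * (1 - c) + S m * s) + cm * (1 - c) + sm * s by ring.
    by rewrite IH1; ring.
  have -> : (S m + sm) * (1 - c) - (C m + cm) * s =
    (S m * (1 - c) - C m * s) + sm * (1 - c) - cm * s by ring.
  by rewrite IH2; ring.
have [H1 H2] := H n.
have p1 := cos2Dsin2 (2 * pi * y); have p2 := cos2Dsin2 (2 * pi * (n%:R * y)).
rewrite -/c -/s in p1; rewrite /dirichlet_sq -/(C n) -/(S n) -/c.
set cn := cos _ in H1 p2 *; set sn := sin _ in H2 p2.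
apply: (@mulfI _ 2) => //.
have -> : 2 * ((C n ^+ 2 + S n ^+ 2) * (1 - c)) =
  (C n ^+ 2 + S n ^+ 2) * ((1 - c) ^+ 2 + (1 - c ^+ 2)) by ring.
have -> : 1 - c ^+ 2 = s ^+ 2 by rewrite -p1; ring.
have -> : (C n ^+ 2 + S n ^+ 2) * ((1 - c) ^+ 2 + s ^+ 2) =
  (C n * (1 - c) + S n * s) ^+ 2 + (S n * (1 - c) - C n * s) ^+ 2 by ring.
rewrite H1 H2 sqrrN.
have -> : sn ^+ 2 = 1 - cn ^+ 2 by rewrite -p2; ring.
by ring.
Qed.

Lemma cos_le0_quarter (x : R) : 4^-1 <= `|x| <= 3 / 4 -> cos (2 * pi * x) <= 0.
Proof.
move=> /andP[x1 x2].
rewrite -cos_norm normrM (@ger0_norm _ (2 * pi)) ?mulr_ge0 ?pi_ge0 //.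
have -> : cos (2 * pi * `|x|) = - cos (2 * pi * `|x| - pi).
  by rewrite -[in LHS](subrK pi (2 * pi * `|x|)) cosDpi.
rewrite oppr_le0 cos_ge0_pihalf //.
have := pi_gt0 R; set p := pi => p0; move: x1 x2; set z := `|x| => x1 x2; nra.
Qed.

(* Dirichlet's kernel bounds [1 - cos] below without any calculus: if [m * y] is
   in [1/4, 3/4] then [1 <= 1 - cos (2 pi m y) <= m^2 (1 - cos (2 pi y))]. *)
Lemma one_sub_cos_ge (y : R) : `|y| <= 2^-1 -> 4 * y ^+ 2 <= 1 - cos (2 * pi * y).
Proof.
move=> y2; have [y4|y4] := leP (4^-1) `|y|.
  have : cos (2 * pi * y) <= 0 by apply: cos_le0_quarter; apply/andP; split => //; lra.
  by move=> ?; rewrite -[y ^+ 2]real_normK ?num_real //; nra.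
have [->|yn0] := eqVneq y 0; first by rewrite mulr0 cos0 expr0n /= mulr0 subrr.
have y0 : 0 < `|y| by rewrite normr_gt0.
have z0 : 0 <= (4 * `|y|)^-1 by rewrite invr_ge0 mulr_ge0.
(* As [|y| < 1/4], the first integer above [1 / (4 |y|)] puts [m |y|] in [[1/4, 1/2]]; the upper end
   gives [4 y^2 <= m^-2], whence the constant [4]. *)
pose m := (Num.truncn (4 * `|y|)^-1).+1.
have m1 : (4 * `|y|)^-1 < m%:R by rewrite /m; exact: (truncnS_gt).
have m2 : m%:R <= (4 * `|y|)^-1 + 1.
  by rewrite /m -[_.+1%:R]natr1 lerD2r truncn_le.
have zy : (4 * `|y|)^-1 * `|y| = 4^-1 by rewrite invfM -mulrA mulVf ?mulr1 ?gt_eqF.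
have h1 : 4^-1 <= `|m%:R * y|.
  rewrite normrM ger0_norm ?ler0n // -zy ler_pM2r //; exact: ltW.
have h2 : `|m%:R * y| <= 2^-1.
  rewrite normrM ger0_norm ?ler0n //.
  have : m%:R * `|y| <= ((4 * `|y|)^-1 + 1) * `|y| by rewrite ler_pM2r.
  rewrite mulrDl zy mul1r; lra.
have c0 : cos (2 * pi * (m%:R * y)) <= 0.
  apply: cos_le0_quarter; apply/andP; split => //; lra.
have := dirichlet_sq_geom m y; have := dirichlet_sq_le m y; have := dirichlet_sq_ge0 m y.
set D := dirichlet_sq m y; have := cos_le1 (2 * pi * y); set c := cos _ => c1 D0 Dm DE.
have k1 : 1 <= m%:R ^+ 2 * (1 - c).
  apply: le_trans (_ : D * (1 - c) <= _); first by rewrite DE; lra.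
  by rewrite ler_wpM2r // subr_ge0.
have k2 : m%:R ^+ 2 * y ^+ 2 <= 4^-1.
  by rewrite -exprMn -real_normK ?num_real //; move: h2; have := normr_ge0 (m%:R * y); nra.
have m0 : 0 < (m%:R : R) ^+ 2 by rewrite exprn_gt0 // ltr0n.
rewrite -(ler_pM2l m0); lra.
Qed.

Lemma nearest_int (y : R) : exists a : int, `|y - a%:~R| <= 2^-1.
Proof.
exists (Num.floor (y + 2^-1)).
have := floor_le (y + 2^-1); have := floorD1_gt (y + 2^-1); rewrite intrD.
by move=> h1 h2; rewrite ler_norml; apply/andP; split; lra.
Qed.

Lemma near_int_of_cos (y d : R) : 0 < d -> 1 - cos (2 * pi * y) < 4 * d ^+ 2 ->
  exists a : int, `|y - a%:~R| < d.
Proof.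
move=> d0 yd; have [a ya] := nearest_int y; exists a.
have := one_sub_cos_ge ya.
rewrite -[- a%:~R]mulrNz cos_period_int mulrNz => h.
have := le_lt_trans h yd.
rewrite -[(y - _) ^+ 2]real_normK ?num_real // ltr_pM2l // => h2.
by rewrite ltNge; apply/negP => h3; move: h2; rewrite ltNge => /negP; apply; nra.
Qed.

End TrigPoly.

(** * Jackson's kernel and its Fourier coefficients *)

Section Jackson.
Variable R : realType.
Local Open Scope complex_scope.

Definition jackson (n : nat) (y : R) : R := dirichlet_sq n y ^+ 2 / n%:R ^+ 4.

(* The factor [1 - cos] only costs [n^-2] in mean, see [jackson_defect_repr]; this is
   what makes the minorant below have positive mean. *)
Definition jackson_defect (n : nat) (y : R) : R := jackson n y * (1 - cos (2 * pi * y)).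

Lemma jackson_ge0 n y : 0 <= jackson n y.
Proof. by rewrite divr_ge0 ?sqr_ge0 ?exprn_ge0. Qed.

Lemma jackson_le1 n y : (0 < n)%N -> jackson n y <= 1.
Proof.
move=> n0; rewrite ler_pdivrMr ?exprn_gt0 ?ltr0n // mul1r.
by rewrite (exprM _ 2 2) lerXn2r ?nnegrE ?dirichlet_sq_ge0 ?exprn_ge0 ?dirichlet_sq_le.
Qed.

(** Within [1 / (8 n)] of an integer all phases [j y], [j < n], are within [1/8] of integers, so
    every cosine is at least [cos (pi / 4)] and nothing cancels. The case [n = 1], where the kernel
    is constant, serves values of [delta] too large for a longer kernel. *)
Lemma jackson_lower n y (a : int) : (0 < n)%N ->
  (n = 1%N) \/ (n%:R * `|y - a%:~R| <= 8^-1) -> cos (pi / 4) ^+ 4 <= jackson n y.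
Proof.
move=> n0 H; set c := cos (pi / 4 : R).
have pi0 := pi_gt0 R.
have c0 : 0 < c by apply: cos_gt0_pihalf; lra.
have c1 : c <= 1 by apply: cos_le1.
have Hj (j : 'I_n) : c <= cos (2 * pi * (j%:R * y)).
  case: H => [n1|H].
    have -> : (j : nat) = 0%N by have := ltn_ord j; lia.
    by rewrite mul0r mulr0 cos0.
  have -> : cos (2 * pi * (j%:R * y)) = cos (2 * pi * (j%:R * (y - a%:~R))) :> R.
    rewrite -[LHS](cos_period_int _ (- (j%:Z * a))) mulrNz intrM -pmulrn.
    by congr cos; ring.
  have Hle : `|j%:R * (y - a%:~R)| <= 8^-1 :> R.
    rewrite normrM normr_nat; apply: le_trans H.
    by rewrite ler_wpM2r // ler_nat ltnW.
  rewrite -[leRHS]cos_norm normrM [ `|2 * pi|]ger0_norm ?mulr_ge0 ?(ltW pi0) //.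
  set z := `|_| in Hle *; have z0 : 0 <= z by apply: normr_ge0.
  rewrite leNgt ltr_cos ?in_itv /= -?leNgt; try by apply/andP; split; nra.
  nra.
have C1 : n%:R * c <= \sum_(j < n) cos (2 * pi * (j%:R * y)).
  rewrite -[leLHS](_ : \sum_(j < n) c = _); first by apply: ler_sum => j _.
  by rewrite sumr_const card_ord mulr_natl.
have D1 : (n%:R * c) ^+ 2 <= dirichlet_sq n y.
  apply: le_trans (_ : (\sum_(j < n) cos (2 * pi * (j%:R * y))) ^+ 2 <= _).
    have n1 : 0 <= n%:R * c by rewrite mulr_ge0 // (ltW c0).
    by rewrite lerXn2r ?nnegrE // (le_trans n1 C1).
  by rewrite lerDl sqr_ge0.
rewrite ler_pdivlMr ?exprn_gt0 ?ltr0n // -exprMn mulrC (exprM _ 2 2).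
by rewrite lerXn2r ?nnegrE ?dirichlet_sq_ge0 ?exprn_ge0 // mulr_ge0 // (ltW c0).
Qed.

(** Additive energy of [{0 .. n-1}] by Cauchy-Schwarz: [n^2] pairs are spread over at most [2 n]
    sums. This bounds the mean of Jackson's kernel below. *)
Lemma card_sum2_eq (n : nat) : 
  n%:R ^+ 3 / 2 <= (#|[set t : ('I_n * 'I_n) * ('I_n * 'I_n) |
     t.1.1 + t.1.2 == t.2.1 + t.2.2 :> nat]%N|%SET)%:R :> R.
Proof.
pose r s : R := \sum_(p : 'I_n * 'I_n) (p.1 + p.2 == s)%N%:R.
have nn : #|{: 'I_n * 'I_n}| = (n * n)%N by rewrite card_prod !card_ord.
have E0 (p : 'I_n * 'I_n) (F : nat -> R) :
    \sum_(s < n.*2) (p.1 + p.2 == s)%N%:R * F s = F (p.1 + p.2)%N.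
  have h : (p.1 + p.2 < n.*2)%N by have := ltn_ord p.1; have := ltn_ord p.2; lia.
  rewrite (bigD1 (Ordinal h)) //= eqxx mul1r big1 ?addr0 // => s.
  by rewrite -val_eqE /= eq_sym => /negbTE ->; rewrite mul0r.
have E1 : \sum_(s < n.*2) r s = n%:R ^+ 2.
  rewrite exchange_big /=.
  transitivity (\sum_(p : 'I_n * 'I_n) (1 : R)).
    apply: eq_bigr => p _; rewrite -[RHS](E0 p (fun=> 1)).
    by apply: eq_bigr => s _; rewrite mulr1.
  by rewrite sumr_const nn -natrX mulnn.
have E2 : \sum_(s < n.*2) r s ^+ 2 = (#|[set t : ('I_n * 'I_n) * ('I_n * 'I_n) |
     t.1.1 + t.1.2 == t.2.1 + t.2.2 :> nat]%N|%SET)%:R.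
  under eq_bigr do rewrite expr2 mulr_suml.
  rewrite exchange_big /=.
  under eq_bigr => p _ do rewrite (E0 p r).
  rewrite pair_bigA /= -sum1_card natr_sum big_mkcond /= [RHS]big_mkcond /=.
  apply: eq_bigr => t _; rewrite inE eq_sym.
  by case: eqP.
(* [n / 2] is the average of [r] over the [2 n] values of [s]. *)
have : 0 <= \sum_(s < n.*2) (r s - n%:R / 2) ^+ 2 by apply: sumr_ge0 => s _; apply: sqr_ge0.
under eq_bigr do rewrite sqrrB.
rewrite big_split /= sumrB E2 sumrMnl -mulr_suml E1 sumr_const card_ord.
rewrite -[X in _ + X]mulr_natl -muln2 natrM.
set x := _%:R => h; rewrite -subr_ge0; apply: le_trans h _.
by rewrite le_eqVlt; apply/orP; left; apply/eqP; field.
Qed.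

Lemma card_fiber3 (n : nat) (h : int) :
  (#|[set t : ('I_n * 'I_n) * ('I_n * 'I_n) |
     ((t.1.1 + t.1.2)%N%:Z - (t.2.1 + t.2.2)%N%:Z)%R == h]|%SET <= n ^ 3)%N.
Proof.
have -> : (n ^ 3 = #|{: 'I_n * 'I_n * 'I_n}|)%N by rewrite !card_prod !card_ord !expnS expn0; lia.
pose g (t : ('I_n * 'I_n) * ('I_n * 'I_n)) := (t.1.1, t.1.2, t.2.1).
rewrite -(@card_in_imset _ _ g) ?max_card // => -[[a1 a2] [a3 a4]] [[b1 b2] [b3 b4]].
rewrite !inE /= => /eqP H1 /eqP H2 [e1 e2 e3]; subst.
suff -> : a4 = b4 by [].
by apply: val_inj => /=; lia.
Qed.

Lemma jackson_complex n y : (jackson n y)%:C =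
  \sum_(t : ('I_n * 'I_n) * ('I_n * 'I_n)) (n%:R ^- 4)%:C *
     cexp2pi (((t.1.1 + t.1.2)%N%:Z - (t.2.1 + t.2.2)%N%:Z)%:~R * y).
Proof.
rewrite /jackson rmorphM rmorphXn /= dirichlet_sq_complex expr2 big_distrlr /= mulrC mulr_sumr.
(* Squaring [dirichlet_sq] gives a sum of two differences; [sw] exchanges the middle indices to read
   it as a difference of two sums. *)
pose sw (t : ('I_n * 'I_n) * ('I_n * 'I_n)) := ((t.1.1, t.2.1), (t.1.2, t.2.2)).
rewrite [RHS](reindex_inj (h := sw)); last first.
  by move=> [[a1 a2] [a3 a4]] [[b1 b2] [b3 b4]] [-> -> -> ->].
rewrite /= -(pair_bigA _ (fun p q : 'I_n * 'I_n => (n%:R ^- 4)%:C *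
     cexp2pi (((p.1 + q.1)%N%:Z - (p.2 + q.2)%N%:Z)%:~R * y))) /=.
apply: eq_bigr => p _; rewrite mulr_sumr; apply: eq_bigr => q _; congr (_ * _).
by rewrite -cexp2piD -mulrDl -intrD; congr cexp2pi; congr (_%:~R * _); rewrite !PoszD; ring.
Qed.

(** The coefficient at [h] is [n^-4] times the number of quadruples whose two sums differ by [h]: at
    most [n^3] of them, and at least [n^3 / 2] for [h = 0] by the energy bound. *)
Lemma jackson_repr n : (0 < n)%N ->
  exists2 a, trig_repr n.*2 n%:R^-1 a (jackson n) & (2 * n%:R)^-1 <= a <= n%:R^-1.
Proof.
move=> n0; have nR : 0 < n%:R :> R by rewrite ltr0n.
pose f (t : ('I_n * 'I_n) * ('I_n * 'I_n)) := (t.1.1 + t.1.2)%N%:Z - (t.2.1 + t.2.2)%N%:Z.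
have S h : \sum_(t | f t == h) (n%:R ^- 4 : R) = 
     (#|[set t | f t == h]|%SET)%:R / n%:R ^+ 4.
  by rewrite sumr_const mulr_natl cardsE.
have Sle h : \sum_(t | f t == h) (n%:R ^- 4 : R) <= n%:R^-1.
  rewrite S ler_pdivrMr ?exprn_gt0 //.
  have -> : n%:R^-1 * n%:R ^+ 4 = (n ^ 3)%:R :> R by rewrite natrX; field; rewrite gt_eqF.
  by rewrite ler_nat card_fiber3.
exists (\sum_(t | f t == 0) n%:R ^- 4); last first.
  rewrite Sle andbT S ler_pdivlMr ?exprn_gt0 //.
  apply: le_trans (_ : n%:R ^+ 3 / 2 <= _).
    by rewrite le_eqVlt; apply/orP; left; apply/eqP; field; rewrite gt_eqF.
  apply: le_trans (card_sum2_eq n) _; rewrite ler_nat; apply: subset_leq_card.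
  by apply/fintype.subsetP => t; rewrite !inE /f subr_eq0.
apply: (@trig_repr_sum _ _ f (fun=> n%:R ^- 4)).
- move=> [[a1 a2] [a3 a4]]; rewrite /f /=.
  have := ltn_ord a1; have := ltn_ord a2; have := ltn_ord a3; have := ltn_ord a4; lia.
- move=> h; apply: le_trans (Sle h); apply: ler_sum => t _.
  by rewrite ger0_norm // invr_ge0 exprn_ge0.
- by move=> y; rewrite jackson_complex.
Qed.

Lemma jackson_defectE n y : (0 < n)%N ->
  jackson_defect n y = dirichlet_sq n y * (1 - cos (2 * pi * (n%:R * y))) / n%:R ^+ 4.
Proof. by move=> n0; rewrite -dirichlet_sq_geom /jackson_defect /jackson; ring. Qed.

(** One of the two squared Dirichlet sums turns [1 - cos (2 pi y)] into [1 - cos (2 pi n y)], whose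
    three exponentials have total weight [1 + 1/2 + 1/2]. At most [n] pairs have a given difference,
    hence the bound [2 n / n^4]. *)
Lemma jackson_defect_repr n : (0 < n)%N ->
  trig_repr n.*2 (2 / n%:R ^+ 3) (n%:R ^- 3) (jackson_defect n).
Proof.
move=> n0; have nR : 0 < n%:R :> R by rewrite ltr0n.
pose s (u : 'I_3) : int := nth 0 [:: 0; n%:Z; - n%:Z] u.
pose w (u : 'I_3) : R := nth 0 [:: 1; - 2^-1; - 2^-1] u / n%:R ^+ 4.
pose f (t : ('I_n * 'I_n) * 'I_3) : int := t.1.1%:Z - t.1.2%:Z + s t.2.
have card_diag (h : int) : (#|[set p : 'I_n * 'I_n | (p.1%:Z - p.2%:Z)%R == h]|%SET <= n)%N.
  rewrite -[X in (_ <= X)%N]card_ord -(@card_in_imset _ _ fst) ?max_card //.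
  move=> [a1 a2] [b1 b2]; rewrite !inE /= => /eqP H1 /eqP H2 e1; subst.
  by congr (_, _); apply: val_inj => /=; lia.
have split3 (F : ('I_n * 'I_n) * 'I_3 -> R) h :
    \sum_(t | f t == h) F t =
    \sum_(u < 3) \sum_(p : 'I_n * 'I_n | p.1%:Z - p.2%:Z == h - s u) F (p, u).
  rewrite (partition_big snd xpredT) //=; apply: eq_bigr => u _.
  rewrite (reindex (fun p => (p, u))) /=; last first.
    by exists fst => [//|[p v]]; rewrite inE /= => /andP[_ /eqP ->].
  by apply: eq_bigl => p; rewrite /f /= eqxx andbT; apply/eqP/eqP => [<-|->]; ring.
have z0 : \sum_(t | f t == 0) w t.2 = n%:R ^- 3.
  rewrite split3 !big_ord_recl big_ord0 /= !addr0.
  (* The shifts [n] and [- n] exceed every difference of two indices below [n], so only the [n]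
     diagonal pairs contribute to the mean. *)
  have far (v : int) (x : R) : (n <= `|v|)%N -> \sum_(p : 'I_n * 'I_n | p.1%:Z - p.2%:Z == v) x = 0.
    move=> nv; rewrite big_pred0 // => -[p1 p2] /=; apply/negbTE/negP => /eqP e.
    by have := ltn_ord p1; have := ltn_ord p2; move: e nv; clear => *; subst; lia.
  rewrite [X in _ + (X + _)]far; last by rewrite /s /=; lia.
  rewrite [X in _ + (_ + X)]far; last by rewrite /s /=; lia.
  rewrite !addr0 sumr_const /w /= /s /= mul1r.
  rewrite (eq_card (B := [set (i, i) | i in 'I_n]%SET)); last first.
    move=> [i j]; rewrite [LHS]unfold_in; apply/idP/imsetP => [h|[l _ [-> ->]]]; last by rewrite !subrr.
    have {}h : i%:Z - j%:Z == 0 :> int := h.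
    by exists i => //; congr (_, _); apply: val_inj; move: h => /=; lia.
  rewrite card_imset ?card_ord; last by move=> i j [].
  by rewrite -[LHS]mulr_natl; field; rewrite gt_eqF.
rewrite -[X in trig_repr _ _ X]z0; apply: (@trig_repr_sum _ _ f (fun t => w t.2)).
- move=> [[a1 a2] [[|[|[|]]] //= u3]]; rewrite /f /s /=;
  have := ltn_ord a1; have := ltn_ord a2; lia.
- move=> h; rewrite split3.
  have B (u : int) (x : R) : 0 <= x -> \sum_(p : 'I_n * 'I_n | p.1%:Z - p.2%:Z == u) x <= n%:R * x.
    move=> x0; rewrite sumr_const -[leLHS]mulr_natl ler_wpM2r // ler_nat.
    by apply: leq_trans (card_diag u); rewrite cardsE.
  apply: (@le_trans _ _ (\sum_(u < 3) n%:R * `|w u|)).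
    apply: ler_sum => u _. exact: (B (h - s u) `|w u| (normr_ge0 _)).
  rewrite !big_ord_recl big_ord0 addr0 /w /= !normrM !normrN normr1 (@ger0_norm _ 2^-1) //.
  rewrite ger0_norm ?invr_ge0 ?exprn_ge0 //.
  by rewrite le_eqVlt; apply/orP; left; apply/eqP; field; rewrite gt_eqF.
- move=> y; rewrite jackson_defectE //.
  have cosE : (1 - cos (2 * pi * (n%:R * y)))%:C =
      \sum_(u < 3) (nth 0 [:: 1; - 2^-1; - 2^-1] u)%:C * cexp2pi ((s u)%:~R * y).
    rewrite !big_ord_recl big_ord0 /s /= mul0r cexp2pi0 mulrNz mulNr -pmulrn.
    rewrite /cexp2pi mulrN cosN sinN; simpc; apply/eqP; rewrite eq_complex /=.
    by apply/andP; split; apply/eqP; field.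
  rewrite !rmorphM /= cosE dirichlet_sq_complex big_distrlr /= pair_bigA /= mulr_suml.
  apply: eq_bigr => -[p u] _ /=; rewrite /f /w /= [X in _ = X * _]rmorphM /= [in RHS]intrD [in RHS]mulrDl [in RHS]cexp2piD; ring.
Qed.

(** Multiply out in complex exponentials and take real parts: the coefficients are real, so only
    cosines survive. *)
Lemma trig_prod k N (c : 'I_k -> int -> R) (p : 'I_k -> R -> R) :
  (forall i y, (p i y)%:C = \sum_(t < N.*2.+1)
       (c i (t%:Z - N%:Z))%:C * cexp2pi ((t%:Z - N%:Z)%:~R * y)) ->
  forall x : 'I_k -> R, \prod_i p i (x i) =
   \sum_(t : {ffun 'I_k -> 'I_(N.*2.+1)}) (\prod_i c i ((t i)%:Z - N%:Z)) *
      cos (2 * pi * dotZ (fun i => (t i)%:Z - N%:Z) x).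
Proof.
move=> H x.
have E : (\prod_i p i (x i))%:C =
   \sum_(t : {ffun 'I_k -> 'I_(N.*2.+1)}) (\prod_i c i ((t i)%:Z - N%:Z))%:C *
      cexp2pi (dotZ (fun i => (t i)%:Z - N%:Z) x).
  rewrite rmorph_prod /=; under eq_bigr do rewrite H.
  rewrite bigA_distr_bigA /=; apply: eq_bigr => t _.
  by rewrite big_split /= rmorph_prod /= -cexp2pi_sum.
have := congr1 (@complex.Re R) E; rewrite /= => ->.
rewrite raddf_sum /=; apply: eq_bigr => t _.
by rewrite /cexp2pi; simpc.
Qed.

End Jackson.

(** * The divisor bound *)

Section DivisorBound.
Variable R : realType.

Lemma powR_le (r x y : R) : 0 <= r -> 0 <= x -> x <= y -> x `^ r <= y `^ r.
Proof. by move=> r0 x0 xy; apply: ge0_ler_powR; rewrite ?nnegrE // (le_trans x0). Qed.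

Lemma powRV (r x : R) : 0 <= x -> x^-1 `^ r = (x `^ r)^-1.
Proof. by move=> x0; rewrite -powR_inv1 // powRAC powR_inv1 ?powR_ge0. Qed.

(** Each divisor is a power of [p], of exponent at most [logn p n], times a divisor of the part of
    [n] prime to [p]. *)
Lemma size_divisors_pfactor (p n : nat) : prime p -> (0 < n)%N ->
  (size (divisors n) <= (logn p n).+1 * size (divisors n`_p^'))%N.
Proof.
move=> pp n0.
rewrite -[X in (X * _)%N](size_iota 0) -(size_allpairs (fun i e => p ^ i * e)%N).
apply: uniq_leq_size; first exact: divisors_uniq.
move=> d; rewrite -dvdn_divisors // => dn.
have d0 := dvdn_gt0 n0 dn.
apply/allpairsP; exists (logn p d, d`_p^')%N; split; rewrite ?[(_, _).1]/= ?[(_, _).2]/=.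
- by rewrite mem_iota add0n ltnS dvdn_leq_log.
- by rewrite -dvdn_divisors ?part_gt0 // partn_dvd.
- by rewrite -p_part partnC.
Qed.

(** The number of divisors is the product of the [a + 1] over the prime powers [p^a] exactly
    dividing [n]. Once [p^eps >= 2], [a + 1 <= 2^a <= p^(a eps)]; each of the finitely many smaller
    primes costs one factor [C]. *)
Lemma divisor_bound (eps : R) : 0 < eps ->
  exists2 C : R, 0 < C & forall n, (0 < n)%N -> (size (divisors n))%:R <= C * n%:R `^ eps.
Proof.
move=> e0; have l2 : 0 < ln 2 :> R by rewrite ln_gt0 // ltr1n.
(* Chosen so that [a + 1 <= C (1 + a eps ln 2) <= C 2^(a eps)]. *)
pose C : R := 1 + (eps * ln 2)^-1.
have el0 : 0 < eps * ln 2 by rewrite mulr_gt0.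
have C1 : 1 <= C by rewrite lerDl invr_ge0 ltW.
have C0 : 0 < C by apply: lt_le_trans C1.
pose P := (Num.truncn ((2 : R) `^ eps^-1)).+1.
have P2 p : (P <= p)%N -> 2 <= p%:R `^ eps :> R.
  move=> Pp; have h : (2 : R) `^ eps^-1 <= p%:R.
    apply: le_trans (_ : P%:R <= _); last by rewrite ler_nat.
    by rewrite /P ltW // truncnS_gt.
  apply: le_trans (powR_le (ltW e0) _ h); rewrite ?powR_ge0 //.
  by rewrite -powRrM mulVf ?gt_eqF // powRr1.
have step p a : prime p -> (a.+1)%:R <= (if (p < P)%N then C else 1) * (p ^ a)%:R `^ eps.
  move=> /prime_gt1 p1.
  have -> : (p ^ a)%:R `^ eps = (p%:R `^ eps) ^+ a :> R.
    by rewrite natrX -!powR_mulrn ?powR_ge0 // -!powRrM mulrC.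
  case: ltnP => [_|Pp].
    have h : (2 : R) `^ eps <= p%:R `^ eps.
      by apply: powR_le; rewrite ?(ltW e0) ?ler_nat.
    apply: le_trans (_ : C * ((2 : R) `^ eps) ^+ a <= _); last first.
      by rewrite ler_wpM2l ?(ltW C0) // lerXn2r ?nnegrE ?powR_ge0.
    rewrite /powR ifF; last by apply/negbTE; rewrite pnatr_eq0.
    rewrite -expRM_natl.
    apply: le_trans (_ : C * (1 + a%:R * (eps * ln 2)) <= _); last first.
      by rewrite ler_wpM2l ?(ltW C0) // expR_ge1Dx.
    rewrite /C mulrDl mul1r mulrDr mulr1 [X in _ <= _ + (_ + X)]mulrCA mulVf ?gt_eqF // mulr1.
    rewrite -natr1; have : 0 <= a%:R * (eps * ln 2) by rewrite mulr_ge0 ?(ltW el0).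
    have : 0 <= (eps * ln 2)^-1 by rewrite invr_ge0 ltW.
    lra.
  rewrite mul1r; apply: le_trans (_ : 2 ^+ a <= _); last first.
    by rewrite lerXn2r ?nnegrE ?powR_ge0 ?P2.
  by rewrite -natrX ler_nat ltn_expl.
(* The product runs over all [i < P], prime or not, which keeps it below [C^P]. Going from [m] prime
   to [p] to [p^a m] with [a > 0], it gains at least the factor needed at [p], and so the induction
   on [n] closes. *)
pose g n : R := \prod_(i < P) (if (i %| n)%N then C else 1).
have g_le n : g n <= C ^+ P.
  rewrite /g -[X in C ^+ X]card_ord -prodr_const; apply: ler_prod => i _.
  by case: ifP => _; rewrite ?lexx ?C1 ?ler01 ?(ltW C0).
have g_ge0 n : 0 <= g n by apply: prodr_ge0 => i _; case: ifP => _; rewrite ?(ltW C0).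
have main n : (0 < n)%N -> (size (divisors n))%:R <= g n * n%:R `^ eps.
  elim/ltn_ind: n => n IH n0; have [n1|n1] := leqP n 1.
    have -> : n = 1%N by lia.
    rewrite powR1 mulr1 [size _]/= /g.
    by apply: (big_ind (fun x => 1 <= x)) => //= [x y|i _]; [exact: mulr_ege1|case: ifP].
  pose p := pdiv n; have pp : prime p by apply: pdiv_prime.
  have pn : (p %| n)%N by apply: pdiv_dvd.
  pose m := (n`_p^')%N.
  have m0 : (0 < m)%N by apply: part_gt0.
  have nE : n = (p ^ logn p n * m)%N by rewrite -p_part partnC.
  have pm : ~~ (p %| m)%N.
    by rewrite -prime_coprime // (pnat_coprime (pnat_id pp)) // part_pnat.
  have l0 : (0 < logn p n)%N by rewrite logn_gt0 mem_primes pp n0 pn.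
  have mn : (m < n)%N.
    rewrite [X in (_ < X)%N]nE ltn_Pmull //.
    by apply: leq_trans (_ : p ^ 1 <= _)%N; [rewrite expn1 prime_gt1|rewrite leq_exp2l ?prime_gt1].
  have := size_divisors_pfactor pp n0; rewrite -/m -(ler_nat R) => h.
  apply: le_trans h _; rewrite natrM.
  have -> : n%:R `^ eps = (p ^ logn p n)%:R `^ eps * m%:R `^ eps :> R.
    by rewrite {1}nE natrM powRM.
  apply: le_trans (ler_pM _ _ (step p (logn p n) pp) (IH m mn m0)) _; rewrite ?ler0n //.
  rewrite -!mulrA mulrCA [leRHS]mulrCA ler_wpM2l ?powR_ge0 // mulrA.
  rewrite ler_wpM2r ?powR_ge0 //.
  have -> : (if (p < P)%N then C else 1) = \prod_(i < P) (if (i == p :> nat) then C else 1).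
    case: ltnP => h.
      rewrite (bigD1 (Ordinal h)) //= eqxx big1 ?mulr1 // => i.
      by rewrite -val_eqE /= => /negbTE ->.
    rewrite big1 // => i _; case: eqP => // e; have := ltn_ord i; lia.
  rewrite -big_split /=; apply: ler_prod => i _.
  have [->|ip] := eqVneq (i : nat) p.
    by rewrite (negbTE pm) pn mulr1 lexx ltW.
  rewrite mul1r; case: ifP => im; first by rewrite nE dvdn_mull // lexx ltW.
  by rewrite ler01 /=; case: ifP => _; rewrite ?C1 ?lexx.
exists (C ^+ P) => [|n n0]; first exact: exprn_gt0.
by apply: le_trans (main n n0) _; rewrite ler_wpM2r ?powR_ge0.
Qed.

End DivisorBound.

(** * Sums over dilated frequencies *)

Section DilatedSum.
Variable R : realType.

(* Shifted indices: [q.+1] runs over [1 .. M], and [t - N] over the nonzero vectors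
   of [{-N .. N}^k]. *)
Definition dilated_sum (k : nat) (F : ('I_k -> int) -> R) (M N : nat) : R :=
  \sum_(q < M) \sum_(t : {ffun 'I_k -> 'I_(N.*2.+1)} | [exists i, t i != N :> nat])
    F (fun i => q.+1%:Z * ((t i)%:Z - N%:Z)).

Lemma box_sum_nat k (F : ('I_k -> int) -> R) (M : nat) :
  box_sum M%:R F = \sum_(t : {ffun 'I_k -> 'I_(M.*2.+1)}) F (fun i => (t i)%:Z - M%:Z).
Proof. by rewrite /box_sum /= (_ : `|Num.floor _|%N = M) // [M%:R]pmulrn intrKfloor. Qed.

Lemma absz_sub_le (N u : nat) : (u < N.*2.+1)%N -> (`|u%:Z - N%:Z| <= N)%N.
Proof. lia. Qed.

Lemma absz_shift_lt (v : int) (L : nat) : (`|v| <= L)%N -> (absz (v + L%:Z)%R < L.*2.+1)%N.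
Proof. lia. Qed.

Lemma absz_shiftK (v : int) (L : nat) : (`|v| <= L)%N -> (absz (v + L%:Z)%R)%:Z - L%:Z = v.
Proof. lia. Qed.

(** Sort the pairs [(q, h)] by the vector [q h]. A nonzero [h] has a nonzero coordinate; there [q]
    divides a fixed nonzero integer of absolute value at most [M N], and [q] determines [h]. So a
    fiber has no more elements than that integer has divisors. *)
Lemma dilated_sum_le k (F : ('I_k -> int) -> R) (M N : nat) (A : R) :
  (forall x, 0 <= F x) ->
  (forall n, (0 < n <= M * N)%N -> (size (divisors n))%:R <= A) ->
  0 <= A ->
  dilated_sum F M N <= A * box_sum (M * N)%:R F.
Proof.
move=> F0 HA A0; rewrite box_sum_nat /dilated_sum pair_big_dep /=.
pose T := ('I_M * {ffun 'I_k -> 'I_(N.*2.+1)})%type.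
pose h (p : T) i : int := p.1.+1%:Z * ((p.2 i)%:Z - N%:Z).
have hMN (p : T) i : (`|h p i| <= M * N)%N.
  by rewrite /h abszM; apply: leq_mul; [exact: ltn_ord p.1|exact: absz_sub_le (ltn_ord _)].
have hb (p : T) i := absz_shift_lt (hMN p i).
have hE (p : T) i := absz_shiftK (hMN p i).
pose g (p : T) : {ffun 'I_k -> 'I_((M * N).*2.+1)} := [ffun i => Ordinal (hb p i)].
rewrite (partition_big g xpredT) //= mulr_sumr; apply: ler_sum => u _.
have gE (p : T) j : g p = u -> h p j = (u j)%:Z - (M * N)%N%:Z.
  by move=> <-; rewrite /g ffunE /= hE.
have FE (p : T) : g p = u -> F (h p) = F (fun i => (u i)%:Z - (M * N)%N%:Z).
  by move=> gp; congr F; apply/funext => i; rewrite gE.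
pose S := [set p : T | [exists i, p.2 i != N :> nat] && (g p == u)]%SET.
rewrite (eq_bigl (fun p => p \in S)); last by move=> p; rewrite inE.
rewrite (eq_bigr (fun=> F (fun i => (u i)%:Z - (M * N)%N%:Z))); last first.
  by move=> p; rewrite inE => /andP[_ /eqP]; exact: FE.
rewrite sumr_const -[leLHS]mulr_natl ler_wpM2r //.
have [->|[p0 p0S]] := set_0Vmem S; first by rewrite cards0.
move: (p0S); rewrite inE => /andP[/existsP[i ti] /eqP gu].
have gi (p : T) : p \in S -> h p i = h p0 i.
  by rewrite inE => /andP[_ /eqP gp]; rewrite !gE.
pose n := `|h p0 i|%N.
have n0 : (0 < n)%N.
  rewrite /n /h abszM muln_gt0 /= absz_gt0 subr_eq0; exact: ti.
have nMN : (n <= M * N)%N by apply: hMN.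
apply: le_trans (HA n _); last by rewrite n0 nMN.
rewrite ler_nat -(@card_in_imset _ _ (fst : T -> 'I_M)); last first.
  move=> p q pS qS pq; have e j : h p j = h q j.
    by move: pS qS; rewrite !inE => /andP[_ /eqP gp] /andP[_ /eqP gq]; rewrite !gE.
  case: p q pq e {pS qS} => [p1 p2] [q1 q2] /= -> e; congr (_, _).
  apply/ffunP => j; apply: val_inj => /=; have := e j; rewrite /h /=.
  by move=> /(mulfI (isT : q1.+1%:Z != 0)) /addIr[].
rewrite cardE -(size_map (fun q : 'I_M => q.+1)); apply: uniq_leq_size.
  by rewrite map_inj_uniq ?enum_uniq // => x y [] /val_inj.
move=> d /mapP[q]; rewrite mem_enum => /imsetP[p pS ->] ->.
rewrite -dvdn_divisors // /n -(gi p pS) /h abszM; exact: dvdn_mulr.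
Qed.

(** The gap between [th0] and [th] absorbs the divisor bound; [|C| + 1] replaces [C], whose sign is
    not known. *)
Lemma dilated_sum_bound k (F : ('I_k -> int) -> R) (C th0 th : R) :
  (forall x, 0 <= F x) ->
  (forall Q, 1 <= Q -> box_sum Q F <= C * Q `^ th0) -> th0 < th ->
  exists2 C', 0 < C' & forall M N, (0 < M)%N -> (0 < N)%N ->
    dilated_sum F M N <= C' * (M * N)%:R `^ th.
Proof.
move=> F0 HF th01; have [|A A0 HA] := @divisor_bound R (th - th0); first by rewrite subr_gt0.
exists (A * (`|C| + 1)) => [|M N M0 N0]; first by rewrite mulr_gt0 // ltr_wpDl.
set n := (M * N)%N; have n0 : (0 < n)%N by rewrite muln_gt0 M0.
have n1 : 1 <= n%:R :> R by rewrite ler1n.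
apply: le_trans (@dilated_sum_le _ F M N (A * n%:R `^ (th - th0)) F0 _ _) _.
- move=> m /andP[m0 mn]; apply: le_trans (HA m m0) _; rewrite ler_wpM2l ?(ltW A0) //.
  by apply: powR_le; rewrite ?ler_nat // subr_ge0 ltW.
- by rewrite mulr_ge0 ?powR_ge0 // ltW.
rewrite -/n -!mulrA ler_wpM2l ?(ltW A0) //.
apply: le_trans (ler_wpM2l (powR_ge0 _ _) (HF n%:R n1)) _.
rewrite mulrCA -powRD ?subrK; last by rewrite pnatr_eq0 -lt0n n0 implybT.
by rewrite ler_wpM2r ?powR_ge0 // (le_trans (ler_norm _)) // lerDl.
Qed.

End DilatedSum.

(** * Coding of nearby integers *)

Section IntOffset.
Variable R : realType.

(** Codes an integer by its offset from [floor z], so that the integers near [z] can be counted in a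
    finite type. [inord] makes the code total; it is faithful for [m] within [L] of [z]. *)
Definition int_offset (L : nat) (z : R) (m : int) : 'I_(L.*2.+1) :=
  inord (absz (m - Num.floor z + L%:Z)).

Lemma int_offsetK L z m : `|m%:~R - z| <= L%:R ->
  m = Num.floor z + (int_offset L z m)%:Z - L%:Z.
Proof.
move=> mz; rewrite /int_offset.
have h1 := floor_le z; have h2 := floorD1_gt z.
have {mz} : - L%:R <= m%:~R - z <= L%:R by rewrite -ler_norml.
move=> /andP[m1 m2].
have l1 : Num.floor z <= m + L%:Z.
  by rewrite -(ler_int R) intrD -pmulrn; lra.
have l2 : m - L%:Z < Num.floor z + 1.
  by rewrite -(ltr_int R) intrB -pmulrn; lra.
by rewrite inordK; lia.
Qed.

End IntOffset.

(** * Digit expansions and words *)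

Section Digits.
Variables (R : realType) (k b : nat).
Hypothesis b2 : (2 <= b)%N.
Implicit Types (d e : nat -> digit k b) (i : 'I_k) (n : nat).

Definition digtrunc d n i : R := \sum_(j < n) ((d j i : nat)%:R * (b%:R ^- j.+1)).

Let bR : 0 < b%:R :> R. Proof. by rewrite ltr0n (ltn_trans _ b2). Qed.

Let digtruncS d n i : digtrunc d n.+1 i = digtrunc d n i + (d n i)%:R * b%:R ^- n.+1.
Proof. by rewrite /digtrunc big_ord_recr. Qed.

Let digtrunc_nondecreasing d i : {homo (digtrunc d)^~ i : n m / (n <= m)%N >-> n <= m}.
Proof.
apply/nondecreasing_seqP => n; rewrite digtruncS lerDl.
by rewrite mulr_ge0 ?ler0n // invr_ge0 exprn_ge0.
Qed.

(** The subtracted [b^-(n + m)] makes the induction close: one more digit adds at most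
    [(b - 1) b^-(n + m + 1)], exactly the decrease of that term. *)
Let digtrunc_ub d i n m : digtrunc d (n + m) i <= digtrunc d n i + b%:R ^- n - b%:R ^- (n + m).
Proof.
elim: m => [|m IH]; first by rewrite addn0 addrK.
rewrite addnS digtruncS.
have h : (d (n + m)%N i)%:R <= b%:R - 1 :> R.
  by rewrite lerBrDr natr1 ler_nat.
have i0 : 0 < b%:R ^- (n + m).+1 :> R by rewrite invr_gt0 exprn_gt0.
have iS : b%:R ^- (n + m) = b%:R * b%:R ^- (n + m).+1 :> R.
  by rewrite exprS invfM mulrA mulfV ?gt_eqF // mul1r.
rewrite iS in IH; move: i0 IH h; set x := b%:R ^- (n + m).+1 => i0 IH h; nra.
Qed.

Let digtrunc_cvg d i : cvgn ((digtrunc d)^~ i).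
Proof.
apply: nondecreasing_is_cvgn; first exact: digtrunc_nondecreasing.
exists 1 => _ [n _ <-]; have := digtrunc_ub d i 0 n.
rewrite add0n /digtrunc big_ord0 expr0 invr1 add0r => /le_trans; apply.
by rewrite gerBl invr_ge0 exprn_ge0.
Qed.

Lemma digtrunc_to_digsum d i : digtrunc d n i @[n --> \oo] --> digsum R d i.
Proof. exact: digtrunc_cvg. Qed.

Lemma digsum_bounds d n i :
  digtrunc d n i <= digsum R d i <= digtrunc d n i + b%:R ^- n.
Proof.
apply/andP; split.
  exact: (nondecreasing_cvgn_le (@digtrunc_nondecreasing d i) (@digtrunc_cvg d i)).
apply: limr_le; first exact: digtrunc_cvg.
exists n => // m /= nm; rewrite -(subnKC nm); apply: le_trans (digtrunc_ub _ _ _ _) _.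
by rewrite gerBl invr_ge0 exprn_ge0.
Qed.

Lemma digtrunc_eq d e n i : (forall j, (j < n)%N -> d j = e j) ->
  digtrunc d n i = digtrunc e n i.
Proof. by move=> H; apply: eq_bigr => j _; rewrite H. Qed.

Lemma digsum_close d e n i : (forall j, (j < n)%N -> d j = e j) ->
  `|digsum R d i - digsum R e i| <= b%:R ^- n.
Proof.
move=> /(digtrunc_eq i) H.
have /andP[a1 a2] := digsum_bounds d n i; have /andP[c1 c2] := digsum_bounds e n i.
by rewrite -H in c1 c2; rewrite ler_norml; apply/andP; split; lra.
Qed.

Lemma digsum_trunc_close d n i : `|digsum R d i - digtrunc d n i| <= b%:R ^- n.
Proof.
have /andP[a1 a2] := digsum_bounds d n i.
have : 0 <= b%:R ^- n :> R by rewrite invr_ge0 exprn_ge0.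
by move=> h; rewrite ler_norml; apply/andP; split; lra.
Qed.

Fixpoint dignum d n i : nat :=
  if n is n'.+1 then (dignum d n' i * b + d n' i)%N else 0%N.

Lemma digtrunc_num d n i : digtrunc d n i = (dignum d n i)%:R / b%:R ^+ n.
Proof.
elim: n => [|n IH]; first by rewrite /digtrunc big_ord0 mul0r.
rewrite digtruncS IH /= natrD natrM exprS; field; by rewrite ?expf_neq0 ?gt_eqF.
Qed.

Lemma dignum_inj d e n : (forall i, dignum d n i = dignum e n i) ->
  forall j, (j < n)%N -> d j = e j.
Proof.
elim: n => // n IH /= H j; rewrite ltnS leq_eqVlt => /orP[/eqP ->|jn].
  apply/ffunP => i; apply: val_inj => /=.
  by have /(congr1 (modn^~ b)) := H i; rewrite !modnMDl !modn_small.
apply: IH jn => i; have /(congr1 (divn^~ b)) := H i.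
by rewrite !divnMDl ?(ltn_trans _ b2) // !divn_small // !addn0.
Qed.

Definition extend_digits n (v : {ffun 'I_n -> digit k b}) (a0 : digit k b) j : digit k b :=
  if insub j is Some j' then v j' else a0.

Lemma extend_digitsE n (v : {ffun 'I_n -> digit k b}) (a0 : digit k b) (j : 'I_n) :
  extend_digits v a0 j = v j.
Proof. by rewrite /extend_digits valK. Qed.

(** Padding with a letter of [D] gives a point of the fractal itself, which a truncated sum need not
    be. *)
Definition prefix_pt (a0 : digit k b) n (v : {ffun 'I_n -> digit k b}) : 'I_k -> R :=
  digsum R (extend_digits v a0).

Lemma prefix_pt_close (a0 : digit k b) n (v : {ffun 'I_n -> digit k b}) d i :
  (forall j : 'I_n, d j = v j) -> `|digsum R d i - prefix_pt a0 v i| <= b%:R ^- n.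
Proof.
move=> H; apply: digsum_close => j jn.
by rewrite (H (Ordinal jn)) -(extend_digitsE v a0).
Qed.

(** Scaled by [b^n], the truncated sums of distinct words are distinct integer vectors, and they lie
    within [L + 1] of [b^n z], truncation costing the extra [1]. This leaves [2 (L + 1) + 1] offsets
    per coordinate. *)
Lemma card_digits_near (a0 : digit k b) n (z : 'I_k -> R) (L : nat) (S : {set {ffun 'I_n -> digit k b}}) :
  (forall v, v \in S -> forall i, `|prefix_pt a0 v i - z i| <= L%:R * b%:R ^- n) ->
  (#|S| <= (L.+1.*2.+1) ^ k)%N.
Proof.
move=> H; pose num (v : {ffun 'I_n -> digit k b}) i := (dignum (extend_digits v a0) n i)%:Z.
pose f (v : {ffun 'I_n -> digit k b}) : {ffun 'I_k -> 'I_(L.+1.*2.+1)} :=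
  [ffun i => int_offset L.+1 (b%:R ^+ n * z i) (num v i)].
have bn : 0 < b%:R ^+ n :> R by rewrite exprn_gt0.
have near v i : v \in S -> `|(num v i)%:~R - b%:R ^+ n * z i| <= L.+1%:R.
  move=> /H /(_ i) h.
  have h2 := digsum_trunc_close (extend_digits v a0) n i.
  rewrite -/(prefix_pt a0 v i) digtrunc_num in h2.
  have -> : (num v i)%:~R - b%:R ^+ n * z i =
      b%:R ^+ n * ((num v i)%:~R / b%:R ^+ n - z i).
    by rewrite mulrBr mulrCA mulfV ?gt_eqF // mulr1.
  rewrite normrM gtr0_norm //.
  have : `|(num v i)%:~R / b%:R ^+ n - z i| <= L.+1%:R * b%:R ^- n.
    rewrite -[L.+1%:R]natr1 mulrDl mul1r.
    have -> : (num v i)%:~R / b%:R ^+ n - z i = (prefix_pt a0 v i - z i) -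
        (prefix_pt a0 v i - (num v i)%:~R / b%:R ^+ n) by ring.
    by apply: le_trans (ler_normB _ _) _; apply: lerD.
  move=> h3; apply: le_trans (ler_wpM2l (ltW bn) h3) _.
  by rewrite mulrCA mulfV ?gt_eqF // mulr1.
have -> : (L.+1.*2.+1 ^ k = #|{ffun 'I_k -> 'I_(L.+1.*2.+1)}|)%N by rewrite card_ffun !card_ord.
rewrite -(@card_in_imset _ _ f) ?max_card // => u v uS vS fuv.
have e : forall i, dignum (extend_digits u a0) n i = dignum (extend_digits v a0) n i.
  move=> i; suff [] : num u i = num v i by [].
  rewrite (int_offsetK (near u i uS)) (int_offsetK (near v i vS)).
  by have := congr1 (fun g : {ffun _} => g i) fuv; rewrite !ffunE => ->.
apply/ffunP => j; rewrite -(extend_digitsE u a0) -(extend_digitsE v a0).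
exact: dignum_inj e j (ltn_ord j).
Qed.

Definition D_words (D : {set digit k b}) n : {set {ffun 'I_n -> digit k b}} :=
  [set v : {ffun 'I_n -> digit k b} | [forall j, v j \in D]]%SET.

Lemma card_D_words D n : #|D_words D n| = (#|D| ^ n)%N.
Proof.
rewrite -[X in (_ ^ X)%N](card_ord n) -card_ffun_on -cardsE; apply: eq_card => v.
by rewrite !inE; apply/forallP/ffun_onP.
Qed.

Lemma prefix_pt_fractal (D : {set digit k b}) (a0 : digit k b) n (v : {ffun 'I_n -> digit k b}) :
  a0 \in D -> v \in D_words D n -> @missing_digit_fractal R k b D (prefix_pt a0 v).
Proof.
move=> dD; rewrite inE => /forallP vD; exists (extend_digits v a0); split => // j.
by rewrite /extend_digits; case: insubP.
Qed.

End Digits.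

(** * Expectations over the random point *)

Section Probability.
Variables (R : realType) (k b : nat) (D : {set digit k b}).
Variables (dsp : measure_display) (Omega : measurableType dsp) (P : probability Omega R).
Variable d : nat -> Omega -> digit k b.
Hypothesis b2 : (2 <= b)%N.
Hypothesis iid : iid_uniform_digits P D d.

Local Notation X := (CL_point R d).
Local Notation Ex f := (Rintegral P setT f).

(** A class stable under the operations used below, on which integrability against a probability is
    automatic. *)
Definition bdd_measurable (f : Omega -> R) : Prop :=
  measurable_fun setT f /\ exists M, forall w, `|f w| <= M.

Lemma bdd_measurable_integrable f : bdd_measurable f -> P.-integrable setT (EFin \o f).
Proof.
move=> [mf [M fM]]; apply: measurable_bounded_integrable => //.
  by rewrite -ge0_fin_numE ?fin_num_measure.
exists M; split; first exact: num_real.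
by move=> x Mx w _; apply: le_trans (fM w) (ltW Mx).
Qed.

Lemma bdd_measurable_cst c : bdd_measurable (fun=> c).
Proof. by split; [exact: measurable_cst|exists `|c|]. Qed.

Lemma bdd_measurableD f g : bdd_measurable f -> bdd_measurable g ->
  bdd_measurable (fun w => f w + g w).
Proof.
move=> [mf [M fM]] [mg [N gN]]; split; first exact: measurable_funD.
by exists (M + N) => w; apply: le_trans (ler_normD _ _) (lerD (fM w) (gN w)).
Qed.

Lemma bdd_measurableM f g : bdd_measurable f -> bdd_measurable g ->
  bdd_measurable (fun w => f w * g w).
Proof.
move=> [mf [M fM]] [mg [N gN]]; split; first exact: measurable_funM.
by exists (M * N) => w; rewrite normrM ler_pM.
Qed.

Lemma bdd_measurable_sum (I : Type) (s : seq I) (Q : pred I) (F : I -> Omega -> R) :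
  (forall i, bdd_measurable (F i)) -> bdd_measurable (fun w => \sum_(i <- s | Q i) F i w).
Proof.
move=> HF; elim: s => [|i s IH].
  by under eq_fun do rewrite big_nil; exact: bdd_measurable_cst.
under eq_fun do rewrite big_cons; case: (Q i) => //; exact: bdd_measurableD.
Qed.

Lemma bdd_measurable_indic A : measurable A -> bdd_measurable (\1_A : Omega -> R).
Proof.
move=> mA; split; first exact: measurable_indic.
exists 1 => w; rewrite indicE; case: (w \in A); by rewrite ?normr1 ?normr0.
Qed.

Lemma Ex_sum (I : Type) (s : seq I) (Q : pred I) (F : I -> Omega -> R) :
  (forall i, bdd_measurable (F i)) ->
  Ex (fun w => \sum_(i <- s | Q i) F i w) = \sum_(i <- s | Q i) Ex (F i).
Proof.
move=> HF; elim: s => [|i s IH].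
  under eq_fun do rewrite big_nil; rewrite big_nil Rintegral_cst // mul0r //.
under eq_fun do rewrite big_cons; rewrite big_cons; case: (Q i) => //.
rewrite RintegralD //; first by rewrite IH.
  exact: bdd_measurable_integrable.
by apply: bdd_measurable_integrable; exact: bdd_measurable_sum.
Qed.

Lemma ExZ c f : bdd_measurable f -> Ex (fun w => c * f w) = c * Ex f.
Proof. by move=> bf; rewrite RintegralZl //; exact: bdd_measurable_integrable. Qed.

Lemma Ex_le f g : bdd_measurable f -> bdd_measurable g -> (forall w, f w <= g w) ->
  Ex f <= Ex g.
Proof.
by move=> bf bg fg; apply: le_Rintegral => //; exact: bdd_measurable_integrable.
Qed.

Lemma Ex_cst c : Ex (fun=> c) = c.
Proof.
rewrite Rintegral_cst // -[RHS]mulr1; congr (_ * _).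
by have := probability_setT P; rewrite /= => ->.
Qed.

Lemma Ex_indic A : measurable A -> Ex (\1_A : Omega -> R) = fine (P A).
Proof. by move=> mA; rewrite /Rintegral integral_indic // setIT. Qed.

Definition cylinder n (v : {ffun 'I_n -> digit k b}) : set Omega :=
  [set w | forall j : 'I_n, d j w = v j].

Lemma cylinderE n (v : {ffun 'I_n -> digit k b}) (a0 : digit k b) :
  cylinder v = \bigcap_(j in [set j | j \in iota 0 n]) [set w | d j w = extend_digits v a0 j].
Proof.
apply/seteqP; split => w H.
  move=> j /=; rewrite mem_iota add0n => /= jn.
  by rewrite (H (Ordinal jn)) -(extend_digitsE v a0).
by move=> j; have := H j; rewrite /= mem_iota add0n ltn_ord extend_digitsE; apply.
Qed.

Let digit0 : digit k b := [ffun=> Ordinal (ltnW b2)].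

Lemma measurable_cylinder n (v : {ffun 'I_n -> digit k b}) : measurable (cylinder v).
Proof.
rewrite (cylinderE v digit0) bigcap_seq.
by apply: bigsetI_measurable => j _; case: iid.
Qed.

Lemma prob_cylinder n (v : {ffun 'I_n -> digit k b}) :
  P (cylinder v) = (if v \in D_words D n then #|D|%:R ^- n else 0)%:E.
Proof.
rewrite (cylinderE v digit0); case: iid => _ [Pd ->]; last exact: iota_uniq.
have -> : iota 0 n = index_iota 0 n by rewrite /index_iota subn0.
rewrite big_mkord; under eq_bigr => j _ do rewrite extend_digitsE Pd.
case: ifPn => [|]; rewrite inE.
  move=> /forallP vD; under eq_bigr do rewrite vD.
  by rewrite prodEFin prodr_const card_ord exprVn.
rewrite negb_forall => /existsP[j vj].
by rewrite (bigD1 j) //= (negbTE vj) mul0e.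
Qed.

Definition prefix n w : {ffun 'I_n -> digit k b} := [ffun j : 'I_n => d j w].

Lemma prefix_indic n (phi : {ffun 'I_n -> digit k b} -> R) w :
  \sum_v phi v * \1_(cylinder v) w = phi (prefix n w).
Proof.
rewrite (bigD1 (prefix n w)) //= indicE mem_set; last by move=> j; rewrite ffunE.
rewrite mulr1 big1 ?addr0 // => v vw; rewrite indicE memNset ?mulr0 // => H.
by move/eqP: vw; apply; apply/ffunP => j; rewrite ffunE.
Qed.

Lemma bdd_measurable_prefix n (phi : {ffun 'I_n -> digit k b} -> R) :
  bdd_measurable (fun w => phi (prefix n w)).
Proof.
under eq_fun do rewrite -prefix_indic.
apply: bdd_measurable_sum => v; apply: bdd_measurableM; first exact: bdd_measurable_cst.
exact/bdd_measurable_indic/measurable_cylinder.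
Qed.

(** The prefix is uniformly distributed over the words with letters in [D]; this is what converts
    expectations into counts of words. *)
Lemma Ex_prefix n (phi : {ffun 'I_n -> digit k b} -> R) :
  Ex (fun w => phi (prefix n w)) = #|D|%:R ^- n * \sum_(v in D_words D n) phi v.
Proof.
under eq_Rintegral do rewrite -prefix_indic.
have bi v : bdd_measurable (\1_(@cylinder n v) : Omega -> R).
  exact/bdd_measurable_indic/measurable_cylinder.
rewrite Ex_sum; last by move=> v; apply: bdd_measurableM => //; exact: bdd_measurable_cst.
rewrite mulr_sumr [RHS]big_mkcond /=; apply: eq_bigr => v _.
rewrite ExZ // Ex_indic; last exact: measurable_cylinder.
by rewrite prob_cylinder /=; case: ifP; rewrite ?mulr0 // mulrC.
Qed.

Lemma measurable_digit_coord j i : measurable_fun setT (fun w => (d j w i : nat)%:R : R).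
Proof.
have -> : (fun w => (d j w i : nat)%:R : R) =
   (fun w => \sum_(a : digit k b) (a i : nat)%:R * \1_[set w | d j w = a] w).
  apply/funext => w; rewrite (bigD1 (d j w)) //= indicE mem_set // mulr1.
  rewrite big1 ?addr0 // => a aw; rewrite indicE memNset ?mulr0 //= => H.
  by move: aw; rewrite H eqxx.
apply: measurable_sum => a; apply: measurable_funM; first exact: measurable_cst.
by apply: measurable_indic; case: iid.
Qed.

Lemma measurable_CL_point i : measurable_fun setT (fun w => X w i).
Proof.
apply: (@measurable_fun_cvg _ _ _ _ (fun n w => digtrunc R (fun j => d j w) n i)).
  move=> n; apply: measurable_sum => j; apply: measurable_funM; last exact: measurable_cst.
  exact: measurable_digit_coord.
by move=> w _; exact: digtrunc_to_digsum.
Qed.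

Lemma bdd_measurable_cos xi : bdd_measurable (fun w => cos (2 * pi * dotZ xi (X w))).
Proof.
split; last by exists 1 => w; exact: cos_max.
apply: measurableT_comp; first by apply: continuous_measurable_fun; exact: continuous_cos.
apply: measurable_funM; first exact: measurable_cst.
apply: measurable_sum => i; apply: measurable_funM; first exact: measurable_cst.
exact: measurable_CL_point.
Qed.

Lemma Ex_cos_le xi : `|Ex (fun w => cos (2 * pi * dotZ xi (X w)))| <= fourier_abs P d xi.
Proof. by rewrite /fourier_abs -sqrtr_sqr ler_wsqrtr // lerDl sqr_ge0. Qed.

Lemma dotZ_scale q xi (x : 'I_k -> R) :
  dotZ xi (fun i => q%:~R * x i) = dotZ (fun i => q * xi i) x.
Proof. by apply: eq_bigr => i _; rewrite intrM; ring. Qed.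

(** After expansion the zero frequency contributes the product of the means, and every other one at
    most the product of the [B i] times a Fourier coefficient at a multiple of [q]. The factors may
    vary with the coordinate because each subtracted term of the minorant has a defect kernel in one
    coordinate. *)
Lemma Ex_trig_prod N (B a : 'I_k -> R) (p : 'I_k -> R -> R) (q : int) :
  (forall i, trig_repr N (B i) (a i) (p i)) ->
  bdd_measurable (fun w => \prod_i p i (q%:~R * X w i)) /\
  `|Ex (fun w => \prod_i p i (q%:~R * X w i)) - \prod_i a i| <= \prod_i B i *
  \sum_(t : {ffun 'I_k -> 'I_(N.*2.+1)} | [exists i, t i != N :> nat])
     fourier_abs P d (fun i => q * ((t i)%:Z - N%:Z)).
Proof.
move=> /choice[c Hc].
have ca i : c i 0 = a i by case: (Hc i).
have cB i h : `|c i h| <= B i by case: (Hc i).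
have cE i y := let: And3 _ _ H := Hc i in H y.
pose fr (t : {ffun 'I_k -> 'I_(N.*2.+1)}) i : int := q * ((t i)%:Z - N%:Z).
have -> : (fun w => \prod_i p i (q%:~R * X w i)) =
    fun w => \sum_(t : {ffun 'I_k -> 'I_(N.*2.+1)}) (\prod_i c i ((t i)%:Z - N%:Z)) *
      cos (2 * pi * dotZ (fr t) (X w)).
  apply/funext => w; rewrite (trig_prod cE); apply: eq_bigr => t _.
  by rewrite dotZ_scale.
have bt (t : {ffun 'I_k -> 'I_(N.*2.+1)}) : bdd_measurable (fun w => (\prod_i c i ((t i)%:Z - N%:Z)) *
      cos (2 * pi * dotZ (fr t) (X w))).
  apply: bdd_measurableM; [exact: bdd_measurable_cst|exact: bdd_measurable_cos].
split; first exact: bdd_measurable_sum.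
rewrite Ex_sum //.
rewrite (eq_bigr (fun t : {ffun 'I_k -> 'I_(N.*2.+1)} => (\prod_i c i ((t i)%:Z - N%:Z)) *
    Ex (fun w => cos (2 * pi * dotZ (fr t) (X w))))); last first.
  by move=> t _; exact: ExZ _ (bdd_measurable_cos (fr t)).
rewrite (bigID (fun t : {ffun 'I_k -> 'I_(N.*2.+1)} => [exists i, t i != N :> nat])) /=.
have N2 : (N < N.*2.+1)%N by lia.
(* Frequencies are stored shifted by [N], so the zero frequency is the constant index [N]. *)
rewrite [X in _ + X - _](big_pred1 [ffun=> Ordinal N2]); last first.
  move=> t; rewrite negb_exists; apply/forallP/eqP => [H|-> i]; last by rewrite ffunE negbK.
  by apply/ffunP => i; apply: val_inj; rewrite ffunE /=; apply/eqP; have := H i; rewrite negbK.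
have -> : \prod_i c i ((([ffun=> Ordinal N2] : {ffun 'I_k -> 'I_(N.*2.+1)}) i : nat)%:Z - N%:Z) =
   \prod_i a i.
  by apply: eq_bigr => i _; rewrite ffunE /= subrr.
have -> : (fun w => cos (2 * pi * dotZ (fr [ffun=> Ordinal N2]) (X w))) = fun=> 1.
  apply/funext => w; rewrite /dotZ big1 ?mulr0 ?cos0 // => i _.
  by rewrite /fr ffunE /= subrr mulr0 mul0r.
rewrite Ex_cst mulr1 addrK mulr_sumr.
apply: le_trans (ler_norm_sum _ _ _) _; apply: ler_sum => t _.
rewrite normrM ler_pM // ?Ex_cos_le // normr_prod.
by apply: ler_prod => i _; rewrite normr_ge0 cB.
Qed.

Lemma Ex_trig_prod_sum N M (B a : 'I_k -> R) (p : 'I_k -> R -> R) (S : pred 'I_M) :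
  (forall i, trig_repr N (B i) (a i) (p i)) ->
  `|\sum_(q < M | S q) Ex (fun w => \prod_i p i (q.+1%:R * X w i)) - (#|S|)%:R * \prod_i a i|
   <= \prod_i B i * dilated_sum (fourier_abs P d) M N.
Proof.
move=> H; have B0 : 0 <= \prod_i B i.
  by apply: prodr_ge0 => i _; have [c [_ /(_ 0) h _]] := H i; apply: le_trans h.
have -> : (#|S|)%:R * \prod_i a i = \sum_(q < M | S q) \prod_i a i.
  by rewrite sumr_const mulr_natl.
rewrite -sumrB; apply: le_trans (ler_norm_sum _ _ _) _.
rewrite /dilated_sum mulr_sumr [leLHS]big_mkcond /=; apply: ler_sum => q _.
case: ifP => _; last by rewrite mulr_ge0 // sumr_ge0 // => t _; exact: sqrtr_ge0.
by have [_] := Ex_trig_prod q.+1%:Z H.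
Qed.

End Probability.

(** * Sup distance, diameters and Hausdorff contents *)

Section SupDist.
Variables (R : realType) (k : nat).
Implicit Types x y z : 'I_k -> R.

Lemma supdist_le x y r : 0 <= r -> (forall i, `|x i - y i| <= r) -> supdist x y <= r.
Proof. by move=> r0 H; apply: bigmax_le. Qed.

Lemma coord_le_supdist x y i : `|x i - y i| <= supdist x y.
Proof. exact: (@le_bigmax _ _ _ _ (fun i => `|x i - y i|)). Qed.

Lemma supdist_ge0 x y : 0 <= supdist x y.
Proof. exact: bigmax_ge_id. Qed.

Lemma diam_le (U : set ('I_k -> R)) r :
  (forall x y, U x -> U y -> supdist x y <= r) -> (diam U <= r%:E)%E.
Proof. by move=> H; apply: ge_ereal_sup => _ [x Ux [y Uy <-]]; rewrite lee_fin H. Qed.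

Lemma diam_bounds (U : set ('I_k -> R)) r : U !=set0 -> (diam U <= r%:E)%E ->
  [/\ 0 <= fine (diam U), fine (diam U) <= r &
   forall x y, U x -> U y -> supdist x y <= fine (diam U)].
Proof.
move=> [x0 Ux0] Ur.
have le_d x y : U x -> U y -> ((supdist x y)%:E <= diam U)%E.
  by move=> Ux Uy; apply: ereal_sup_ubound; exists x => //; exists y.
have d0 : (0 <= diam U)%E.
  by apply: le_trans (le_d x0 x0 Ux0 Ux0); rewrite lee_fin supdist_ge0.
have fd : diam U \is a fin_num.
  by rewrite ge0_fin_numE // (le_lt_trans Ur) // ltry.
split; first exact: fine_ge0.
  by rewrite -lee_fin fineK.
by move=> x y Ux Uy; rewrite -lee_fin fineK // le_d.
Qed.

Lemma cover_term_ge0 s (U : set ('I_k -> R)) : (0 <= cover_term s U)%E.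
Proof. by rewrite /cover_term; case: ifP => // _; rewrite lee_fin powR_ge0. Qed.

Lemma cover_term_le s r (U : set ('I_k -> R)) : 0 <= s ->
  (diam U <= r%:E)%E -> (cover_term s U <= (r `^ s)%:E)%E.
Proof.
move=> s0 Ur; rewrite /cover_term; case: ifPn => [_|/set0P U0].
  by rewrite lee_fin powR_ge0.
have [d0 dr _] := diam_bounds U0 Ur.
by rewrite lee_fin powR_le.
Qed.

Lemma hausdorff_content_ge0 s e (A : set ('I_k -> R)) : (0 <= hausdorff_content s e A)%E.
Proof.
apply: le_ereal_inf_tmp => _ [U _ <-].
by apply: nneseries_ge0 => i _ _; exact: cover_term_ge0.
Qed.

(** The finite cover is continued by empty sets, for which [cover_term] is [0] even when [s = 0]. *)
Lemma hausdorff_content_finite_cover s e r (T : finType) (V : T -> set ('I_k -> R)) A :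
  0 <= s -> r <= e -> A `<=` \bigcup_t V t -> (forall t, (diam (V t) <= r%:E)%E) ->
  (hausdorff_content s e A <= (#|T|%:R * r `^ s)%:E)%E.
Proof.
move=> s0 re AV Vr.
pose U (i : nat) := if insub i is Some j then V (enum_val (j : 'I_#|T|)) else set0.
apply: ge_ereal_inf; exists (\sum_(i <oo) cover_term s (U i))%E.
  exists U => //; split.
    move=> x /AV[t _ Vx]; exists (enum_rank t : nat) => //.
    by rewrite /U valK enum_rankK.
  move=> i; rewrite /U; case: insubP => [j _ _|_].
    by apply: le_trans (Vr _) _; rewrite lee_fin.
  by apply: (@le_trans _ _ r%:E); [exact: diam_le|rewrite lee_fin].
apply: lime_le; first by apply: is_cvg_nneseries => i _ _; exact: cover_term_ge0.
apply: nearW => n.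
pose c i : R := if (i < #|T|)%N then r `^ s else 0.
apply: (@le_trans _ _ (\sum_(0 <= i < n) (c i)%:E)%E).
  apply: lee_sum => i _; rewrite /U /c; case: insubP => [j -> _|/negbTE ->].
    by apply: cover_term_le s0 (Vr _).
  by rewrite /cover_term eqxx.
have -> : (\sum_(0 <= i < n) (c i)%:E)%E = ((minn n #|T|)%:R * r `^ s)%:E.
  elim: n => [|n IH]; first by rewrite big_geq // min0n mul0r.
  rewrite big_nat_recr //= IH -EFinD; congr (_%:E); rewrite /c; case: ltnP => h.
    by rewrite (minn_idPl h) -[n.+1%:R]natr1 mulrDl mul1r.
  by rewrite addr0 (minn_idPr (leqW h)).
by rewrite lee_fin ler_wpM2r ?powR_ge0 // ler_nat geq_minr.
Qed.

End SupDist.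

(** * The Hausdorff dimension of the fractal *)

Section HausdorffDimension.
Variables (R : realType) (k b : nat) (D : {set digit k b}).
Hypothesis b2 : (2 <= b)%N.
Hypothesis D2 : (2 <= #|D|)%N.
Local Notation K := (@missing_digit_fractal R k b D).

Definition simdim : R := ln #|D|%:R / ln b%:R.

Let bR : 0 < b%:R :> R. Proof. by rewrite ltr0n (ltn_trans _ b2). Qed.
Let DR : 0 < #|D|%:R :> R. Proof. by rewrite ltr0n (ltn_trans _ D2). Qed.
Let lnb : 0 < ln b%:R :> R. Proof. by rewrite ln_gt0 // ltr1n. Qed.

Lemma simdim_gt0 : 0 < simdim.
Proof. by rewrite divr_gt0 // ln_gt0 // ltr1n. Qed.

Lemma powR_simdim : b%:R `^ simdim = #|D|%:R.
Proof. by rewrite /powR gt_eqF // /simdim divfK ?gt_eqF // lnK. Qed.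

Lemma powR_simdimXn n : (b%:R ^+ n) `^ simdim = #|D|%:R ^+ n.
Proof.
by rewrite -powR_mulrn ?(ltW bR) // -powRrM mulrC powRrM powR_simdim powR_mulrn // ltW.
Qed.

Lemma powR_simdimXNn n : (b%:R ^- n) `^ simdim = #|D|%:R ^- n.
Proof. by rewrite powRV ?exprn_ge0 // powR_simdimXn. Qed.

Let digit0 : digit k b := [ffun=> Ordinal (ltnW b2)].

Lemma base_power_between (r : R) : 0 < r <= 1 ->
  exists n, b%:R ^- n <= r /\ r < b%:R * b%:R ^- n.
Proof.
move=> /andP[r0 r1].
have ex : exists n, b%:R ^- n <= r.
  exists (Num.truncn r^-1).+1; rewrite -[leRHS]invrK lef_pV2 ?posrE ?invr_gt0 ?exprn_gt0 //.
  have h := truncnS_gt r^-1; apply: le_trans (ltW h) _.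
  by rewrite -natrX ler_nat ltnW // ltn_expl.
pose n := ex_minn ex; exists n; rewrite /n; case: ex_minnP => m mr mmin; split => //.
case: m mr mmin => [|m] mr mmin.
  by rewrite expr0 invr1 mulr1 (le_lt_trans r1) // ltr1n.
rewrite exprS invfM mulrA mulfV ?gt_eqF // mul1r ltNge; apply/negP => /mmin.
by rewrite ltnn.
Qed.

(** Cover by the [#D^n] cylinders of level [n], of diameter at most [b^-n]: the content is at most
    [(#D / b^s)^n], which tends to [0] for [s] above [simdim]. *)
Lemma simdim_upper s : simdim < s -> hausdorff_measure s K = 0%E.
Proof.
move=> ss; have s0 : 0 < s by apply: lt_trans ss; exact: simdim_gt0.
have content0 e : 0 < e -> hausdorff_content s e K = 0%E.
  move=> e0; apply/eqP; rewrite eq_le hausdorff_content_ge0 andbT.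
  apply/lee_addgt0Pr => eps eps0; rewrite add0e.
  pose rho : R := #|D|%:R / b%:R `^ s.
  have rho0 : 0 <= rho by rewrite divr_ge0 ?powR_ge0.
  have rho1 : `|rho| < 1.
    rewrite ger0_norm // ltr_pdivrMr ?powR_gt0 // mul1r -powR_simdim.
    by rewrite /powR gt_eqF // ltr_expR ltr_pM2r.
  have b1 : `|b%:R^-1| < 1 :> R.
    by rewrite ger0_norm ?invr_ge0 // invf_lt1 // ltr1n.
  have h1 := cvg_expr rho1; have h2 := cvg_expr b1.
  have n1 : \forall n \near \oo, rho ^+ n < eps.
    exact: (cvgr_lt 0 h1).
  have n2 : \forall n \near \oo, b%:R^-1 ^+ n < e :> R.
    exact: (cvgr_lt 0 h2).
  have [n [n3 n4]] : exists n, rho ^+ n < eps /\ b%:R^-1 ^+ n < e :> R.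
    have [N _ HN] := filterI n1 n2; exists N; exact: HN (leqnn N).
  rewrite exprVn in n4.
  pose V (v : {v | v \in D_words D n}) : set ('I_k -> R) :=
    [set x | exists d : nat -> digit k b, (forall j : 'I_n, d j = val v j) /\ x = digsum R d].
  apply: le_trans (@hausdorff_content_finite_cover _ _ s e (b%:R ^- n) _ V K _ _ _ _) _.
  - exact: ltW.
  - exact: ltW.
  - move=> x [d [dD ->]].
    have wD : [ffun j : 'I_n => d j] \in D_words D n.
      by rewrite inE; apply/forallP => j; rewrite ffunE.
    by exists (exist (fun v => is_true (v \in D_words D n)) _ wD) => //; exists d; split => // j; rewrite /= ffunE.
  - move=> v; apply: diam_le => _ _ [d [dv ->]] [d' [dv' ->]].
    apply: supdist_le; first by rewrite invr_ge0 exprn_ge0.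
    move=> i; apply: digsum_close => // j jn.
    by rewrite (dv (Ordinal jn)) (dv' (Ordinal jn)).
  rewrite lee_fin card_sig (eq_card (B := D_words D n)) // card_D_words natrX.
  rewrite powRV ?exprn_ge0 //.
  have -> : (b%:R ^+ n) `^ s = (b%:R `^ s) ^+ n :> R.
    by rewrite -!powR_mulrn ?powR_ge0 // powRAC.
  by rewrite -exprVn -exprMn ltW.
apply/eqP; rewrite eq_le; apply/andP; split.
  by apply: ge_ereal_sup => _ [e /= e0 <-]; rewrite content0.
by apply: ereal_sup_ubound; exists 1; rewrite /= ?content0.
Qed.

Variables (dsp : measure_display) (Omega : measurableType dsp) (P : probability Omega R).
Variable d : nat -> Omega -> digit k b.
Hypothesis iid : iid_uniform_digits P D d.

Definition prefix_event n (A : {set {ffun 'I_n -> digit k b}}) : set Omega :=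
  [set w | prefix d n w \in A].

Lemma measurable_prefix_event n A : measurable (@prefix_event n A).
Proof.
have -> : prefix_event A = \bigcup_(v in [set` A]) cylinder d v.
  apply/seteqP; split => [w /= wA|w [v /= vA vw]].
    by exists (prefix d n w) => // j; rewrite ffunE.
  rewrite /prefix_event /=; have -> // : prefix d n w = v by apply/ffunP => j; rewrite ffunE vw.
apply: fin_bigcup_measurable; first exact: finite_finset.
by move=> v _; exact: (measurable_cylinder b2 iid).
Qed.

Lemma prob_prefix_event n A :
  P (@prefix_event n A) = (#|A :&: D_words D n|%:R * #|D|%:R ^- n)%:E.
Proof.
have mA := @measurable_prefix_event n A.
rewrite -[LHS]fineK ?fin_num_measure //; congr (_%:E).
rewrite -Ex_indic //.
have -> : (\1_(prefix_event A) : Omega -> R) = fun w => (prefix d n w \in A)%:R.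
  apply/funext => w; rewrite indicE; congr (_%:R); congr nat_of_bool.
  by apply/idP/idP => [/set_mem|h]; [|apply/mem_set].
rewrite (Ex_prefix b2 iid (fun v => (v \in A)%:R)). rewrite mulrC; congr (_ * _).
rewrite -sum1_card natr_sum [RHS]big_mkcond [LHS]big_mkcond; apply: eq_bigr => v _.
by rewrite finset.in_setI; case: (v \in A); case: (v \in D_words D n).
Qed.

Definition meets n (U : set ('I_k -> R)) : {set {ffun 'I_n -> digit k b}} :=
  [set v : {ffun 'I_n -> digit k b} |
     `[< exists2 x, U x & forall i, `|x i - prefix_pt R digit0 v i| <= b%:R ^- n >]]%SET.

(** A measurable substitute for the event that the random point lies in [U]: the members of a cover
    are arbitrary sets, so that event need not be measurable. It contains that event, and each level
    of the intersection depends on finitely many digits. *)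
Definition hit_event (U : set ('I_k -> R)) : set Omega :=
  \bigcap_n prefix_event (@meets n U).

Lemma measurable_hit_event U : measurable (hit_event U).
Proof. by apply: bigcapT_measurable => n; exact: measurable_prefix_event. Qed.

Lemma prob_hit_event_le_prefix U n L : U !=set0 ->
  (forall x y, U x -> U y -> supdist x y <= L%:R * b%:R ^- n) ->
  (P (hit_event U) <= ((L.+2.*2.+1 ^ k)%:R * #|D|%:R ^- n)%:E)%E.
Proof.
move=> [x0 Ux0] UL.
apply: (@le_trans _ _ (P (prefix_event (meets n U)))).
  apply: le_measure; [exact/mem_set/measurable_hit_event|exact/mem_set/measurable_prefix_event|].
  by move=> w; apply.
rewrite prob_prefix_event lee_fin ler_wpM2r ?invr_ge0 ?exprn_ge0 // ler_nat.
apply: leq_trans (subset_leq_card (subsetIl _ _)) _.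
apply: (@card_digits_near R _ _ b2 digit0 _ x0) => v; rewrite inE => /asboolP[x Ux xv] i.
have h1 := xv i; have h2 := le_trans (coord_le_supdist x x0 i) (UL x x0 Ux Ux0).
have -> : prefix_pt R digit0 v i - x0 i = (x i - x0 i) - (x i - prefix_pt R digit0 v i) by ring.
by apply: le_trans (ler_normB _ _) _; rewrite -[L.+1%:R]natr1 mulrDl mul1r lerD.
Qed.

(** At the level with [b^-n <= diam U < b^(1 - n)] boundedly many words meet [U], each of
    probability [#D^-n = (b^-n)^simdim], which is at most [(diam U)^s] because [diam U <= 1]. *)
Lemma prob_hit_event_le s U : 0 <= s -> s <= simdim -> (diam U <= 1%:E)%E ->
  (P (hit_event U) <= (b.+2.*2.+1 ^ k)%:R%:E * cover_term s U)%E.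
Proof.
move=> s0 sk U1; rewrite /cover_term; case: ifPn => [/eqP ->|/set0P U0].
  rewrite mule0 (_ : hit_event set0 = set0) ?measure0 //.
  by apply/seteqP; split => w // /(_ 0%N I); rewrite /prefix_event /= inE => /asboolP[].
have [d0 d1 dU] := diam_bounds U0 U1; set r := fine (diam U) in d0 d1 dU *.
set A := (_ ^ k)%N; have A0 : 0 <= A%:R :> R by [].
rewrite -EFinM.
(* No level matches diameter [0]; there the probability vanishes, since the level may be taken
   arbitrarily deep and [#D >= 2]. *)
have [r0|r0] := eqVneq r 0.
  have bnd n : fine (P (hit_event U)) <= A%:R * #|D|%:R ^- n.
    rewrite -lee_fin fineK ?fin_num_measure //; last exact: measurable_hit_event.
    apply: prob_hit_event_le_prefix => // x y Ux Uy; apply: le_trans (dU x y Ux Uy) _.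
    by rewrite r0 mulr_ge0 // invr_ge0 exprn_ge0.
  apply: (@le_trans _ _ 0%:E); last by rewrite lee_fin mulr_ge0 ?powR_ge0.
  rewrite -[leLHS]fineK ?fin_num_measure //; last exact: measurable_hit_event.
  rewrite lee_fin leNgt; apply/negP => p0; move: bnd; set p := fine _ in p0 * => bnd.
  pose n := (Num.truncn (A%:R / p)).+1.
  have := bnd n; rewrite ler_pdivlMr ?exprn_gt0 //; apply/negP; rewrite -ltNge.
  have : A%:R / p < n%:R by exact: truncnS_gt.
  rewrite ltr_pdivrMr // mulrC => /lt_le_trans; apply; rewrite ler_pM2l //.
  by rewrite -natrX ler_nat ltnW // ltn_expl.
have rgt0 : 0 < r by rewrite lt_neqAle eq_sym r0.
have [n [n1 n2]] : exists n, b%:R ^- n <= r /\ r < b%:R * b%:R ^- n.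
  by apply: base_power_between; rewrite rgt0.
apply: le_trans (@prob_hit_event_le_prefix U n b U0 _) _.
  by move=> x y Ux Uy; apply: le_trans (dU x y Ux Uy) (ltW n2).
rewrite lee_fin ler_wpM2l // -powR_simdimXNn.
apply: (@le_trans _ _ (r `^ simdim)).
  by apply: powR_le; rewrite ?(ltW simdim_gt0) ?invr_ge0 ?exprn_ge0.
by rewrite ger_powR // rgt0.
Qed.

(** Mass distribution principle: up to null events the hit events of a cover exhaust the
    probability, so [A] times the sum of its cover terms is at least [1]. *)
Lemma simdim_lower s : 0 <= s -> s <= simdim -> hausdorff_measure s K <> 0%E.
Proof.
move=> s0 sk; set A : R := (b.+2.*2.+1 ^ k)%:R.
have A0 : 0 < A by rewrite ltr0n expn_gt0.
suff h : ((A^-1)%:E <= hausdorff_content s 1 K)%E.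
  move=> H0; have : (hausdorff_content s 1 K <= 0)%E.
    by rewrite -H0; apply: ereal_sup_ubound; exists 1; rewrite /=.
  by move/(le_trans h); rewrite lee_fin leNgt invr_gt0 A0.
apply: le_ereal_inf_tmp => _ [U [KU U1] <-].
(* The digits lie in [D] only almost surely; the null events where a prefix leaves [D] are added so
   that the union is everything. *)
have mE n : measurable (hit_event (U n) `|` prefix_event (~: D_words D n)).
  by apply: measurableU; [exact: measurable_hit_event|exact: measurable_prefix_event].
have cover : setT `<=` \bigcup_n (hit_event (U n) `|` prefix_event (~: D_words D n)).
  move=> w _; have [[n nw]|H] := pselect (exists n, prefix_event (~: D_words D n) w).
    by exists n => //; right.
  have wD j : d j w \in D.
    apply: contrapT => jD; apply: H; exists j.+1; rewrite /prefix_event /= !inE.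
    apply/negP => /forallP /(_ ord_max); rewrite ffunE; exact: jD.
  have [n _ Un] : (\bigcup_i U i) (CL_point R d w) by apply: KU; exists (fun j => d j w).
  exists n => //; left => m _; rewrite /prefix_event /= inE; apply/asboolP.
  exists (CL_point R d w) => // i; apply: prefix_pt_close => // j; by rewrite ffunE.
have H : (1 <= \sum_(n <oo) P (hit_event (U n) `|` prefix_event (~: D_words D n)))%E.
  apply: (@le_trans _ _ (P setT)); first by rewrite probability_setT.
  exact: measure_sigma_subadditive.
have : (1 <= A%:E * \sum_(i <oo) cover_term s (U i))%E.
  rewrite -nneseriesZl; last by move=> i _; exact: cover_term_ge0.
  apply: le_trans H _; apply: lee_nneseries => // n _.
  apply: le_trans (measureU2 _ _ _) _.
  - exact: measurable_hit_event.
  - exact: measurable_prefix_event.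
  rewrite [X in (_ + X)%E]prob_prefix_event finset.setIC finset.setICr cards0 mul0r adde0.
  exact: prob_hit_event_le.
by rewrite -lee_pdivrMl // mule1.
Qed.

Lemma dimH_missing_digit : dimH K = simdim.
Proof.
have inS e : 0 < e -> [set s : R | 0 <= s /\ hausdorff_measure s K = 0%E] (simdim + e).
  move=> e0; split; first by rewrite addr_ge0 // ltW // simdim_gt0.
  by apply: simdim_upper; rewrite ltrDl.
apply/eqP; rewrite eq_le; apply/andP; split.
  apply/ler_addgt0Pr => e e0; apply: ge_inf; last exact: inS.
  by exists 0 => s [].
apply: lb_le_inf; first by exists (simdim + 1); apply: inS.
move=> s [s0 Hs]; rewrite leNgt; apply/negP => sk.
exact: simdim_lower s0 (ltW sk) Hs.
Qed.

End HausdorffDimension.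

(** * Cardinality lemmas *)

Section Cardinals.

Lemma card_fset_set_image (U : choiceType) (T : finType) (S : {set T}) (f : T -> U) (A : set U) :
  (forall x, A x -> exists2 t, t \in S & f t = x) ->
  finite_set A /\ (#|` fset_set A|%fset <= #|S|)%N.
Proof.
move=> H; have fA : finite_set A.
  apply: (sub_finite_set (B := f @` [set` S])); first by move=> x /H[t tS <-]; exists t.
  exact/finite_image/finite_finset.
split => //; rewrite cardE -(size_map f); apply: uniq_leq_size; first exact: fset_uniq.
move=> x xA; have /set_mem/H[t tS <-] : x \in A by rewrite -in_fset_set.
by apply: map_f; rewrite mem_enum.
Qed.

Lemma card_fibers (U : eqType) (T : finType) (S : {set T}) (h : T -> U) (s : seq U) (B : nat) :
  (forall t, t \in S -> h t \in s) ->
  (forall x, (#|[set t in S | h t == x]| <= B)%N) -> (#|S| <= size s * B)%N.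
Proof.
move=> hS hB; apply: (@leq_trans (\sum_(x <- s) \sum_(t in S) (h t == x))%N).
  rewrite exchange_big /= -sum1_card; apply: leq_sum => t tS.
  rewrite (eq_bigr (fun x => (pred1 (h t) x : nat))); last first.
    by move=> x _; rewrite /= eq_sym.
  by rewrite -big_mkcond sum1_count -has_count has_pred1 hS.
apply: (@leq_trans (\sum_(x <- s) B)%N).
  apply: leq_sum => x _; rewrite -big_mkcondr sum1dep_card.
  exact: hB.
by rewrite big_const_seq count_predT iter_addn_0 mulnC.
Qed.

(** Reversing [{0 .. M-1}] sends the complement of the set into the set. *)
Lemma card_upper_half (M : nat) : (M <= 2 * #|[pred q : 'I_M | (M < 2 * q.+1)%N]|)%N.
Proof.
set S := [pred q : 'I_M | _]; rewrite -{1}[M]card_ord -(cardC S) mul2n -addnn leq_add2l.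
rewrite -(fintype.card_image (@rev_ord_inj M)); apply: subset_leq_card.
apply/fintype.subsetP => _ /fintype.imageP[q qS ->]; move: qS; rewrite !inE /= -leqNgt.
by have := ltn_ord q; lia.
Qed.

End Cardinals.

Lemma trunc_bounds (R : realType) (Q : R) : 1 <= Q ->
  [/\ (0 < Num.truncn Q)%N, (Num.truncn Q)%:R <= Q & Q < (Num.truncn Q)%:R + 1].
Proof.
move=> Q1; split.
- by rewrite truncn_gt0.
- by rewrite truncn_le // (le_trans _ Q1).
- by rewrite natr1 truncnS_gt.
Qed.

(** * From rational points to expectations, and both bounds for the count *)

Section Counting.
Variables (R : realType) (k b : nat) (D : {set digit k b}).
Hypothesis b2 : (2 <= b)%N.
Variable a0 : digit k b.
Hypothesis a0D : a0 \in D.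
Local Notation K := (@missing_digit_fractal R k b D).
Variables (dsp : measure_display) (Omega : measurableType dsp) (P : probability Omega R).
Variable d : nat -> Omega -> digit k b.
Hypothesis iid : iid_uniform_digits P D d.
Local Notation X := (CL_point R d).
Local Notation Ex f := (Rintegral P setT f).

Let bR : 0 < b%:R :> R. Proof. by rewrite ltr0n (ltn_trans _ b2). Qed.
Let DR : 0 < #|D|%:R :> R. Proof. by rewrite ltr0n; apply/card_gt0P; exists a0. Qed.

Definition near_int n (r : R) (v : {ffun 'I_n -> digit k b}) (q : nat) : Prop :=
  exists a : {ffun 'I_k -> int}, forall i, `|q%:R * prefix_pt R a0 v i - (a i)%:~R| <= r.

Definition good_pairs n M (S : pred 'I_M) (r : R) : {set {ffun 'I_n -> digit k b} * 'I_M} :=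
  [set vq : {ffun 'I_n -> digit k b} * 'I_M |
     [&& vq.1 \in D_words D n, S vq.2 & `[< near_int r vq.1 vq.2.+1 >]]]%SET.

Lemma card_good_pairs n M (S : pred 'I_M) r :
  (#|good_pairs n S r|)%:R * #|D|%:R ^- n =
  Ex (fun w => \sum_(q < M | S q) `[< near_int r (prefix d n w) q.+1 >]%:R).
Proof.
rewrite (Ex_prefix b2 iid
  (fun v => \sum_(q < M | S q) `[< near_int r v q.+1 >]%:R)) mulrC; congr (_ * _).
rewrite pair_big_dep /= -sum1_card natr_sum.
rewrite [LHS]big_mkcond [RHS]big_mkcond /=; apply: eq_bigr => -[v q] _.
by rewrite [in LHS]finset.in_set /=; case: (v \in _) => //; case: (S q) => //; case: asbool.
Qed.

Lemma setdist_lt (x : 'I_k -> R) (e : R) : setdist x K < e ->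
  exists2 y, K y & supdist x y < e.
Proof.
move=> xe; have hi : has_inf [set supdist x y | y in K].
  split; last by exists 0 => _ [y _ <-]; exact: supdist_ge0.
  exists (supdist x (digsum R (fun=> a0))), (digsum R (fun=> a0)) => //.
  by exists (fun=> a0).
have [|_ [y Ky <-] h] := inf_adherent (eps := e - setdist x K) _ hi; first by rewrite subr_gt0.
by exists y => //; move: h; rewrite /setdist subrKC.
Qed.

Lemma setdist_le (x y : 'I_k -> R) : K y -> setdist x K <= supdist x y.
Proof.
move=> Ky; apply: ge_inf; last by exists y.
by exists 0 => _ [z _ <-]; exact: supdist_ge0.
Qed.

(** The word is read off the first [n] digits of a point of the fractal close to [a / q]; as
    [3 delta < 3], seven integers remain for each coordinate of [a]. *)
Lemma count_le_good_pairs n (Q delta : R) : 1 <= Q -> 0 < delta < 1 ->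
  b%:R ^- n <= delta / Q ->
  finite_set (rat_points_near K Q delta) /\
  (count_N K Q delta <= #|good_pairs n (M := Num.truncn Q) xpredT (3 * delta)| * 7 ^ k)%N.
Proof.
move=> Q1 /andP[d0 d1] bn; have Q0 : 0 < Q by apply: lt_le_trans Q1.
have [M0 MQ QM] := trunc_bounds Q1; set M := Num.truncn Q in M0 MQ QM *.
pose f (t : ({ffun 'I_n -> digit k b} * 'I_M) * {ffun 'I_k -> 'I_7}) : {ffun 'I_k -> int} * int :=
  ([ffun i => Num.floor (t.1.2.+1%:R * prefix_pt R a0 t.1.1 i) + (t.2 i)%:Z - 3%:Z],
   t.1.2.+1%:Z).
have [|fN cN] := @card_fset_set_image _ _
   (finset.setX (good_pairs n xpredT (3 * delta)) [set: {ffun 'I_k -> 'I_7}]%SET) f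
   (rat_points_near K Q delta); last first.
  by split => //; move: cN; rewrite cardsX cardsT card_ffun !card_ord.
move=> [a q] [/= q1 [qQ adist]].
have [q' qE] : exists q', q = q'.+1%:Z by exists `|q|%N.-1; lia.
subst q; rewrite -pmulrn in qQ adist.
have q'M : (q' < M)%N.
  by rewrite -ltnS -(ltr_nat R); apply: le_lt_trans qQ _; rewrite -[M.+1%:R]natr1.
have q0 : 0 < q'.+1%:R :> R by [].
(* Doubling the radius makes the inequality strict, so a point of the fractal is found without
   knowing that the infimum is attained. *)
have [|y [e [eD yE]] ay] := @setdist_lt (fun i => (a i)%:~R / q'.+1%:R) (2 * delta / Q).
  apply: le_lt_trans adist _; rewrite ltr_pM2r ?invr_gt0 //; lra.
pose v : {ffun 'I_n -> digit k b} := [ffun j : 'I_n => e j].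
have vD : v \in D_words D n by rewrite inE; apply/forallP => j; rewrite ffunE.
have near i : `|q'.+1%:R * prefix_pt R a0 v i - (a i)%:~R| <= 3 * delta.
  have h1 : `|digsum R e i - prefix_pt R a0 v i| <= delta / Q.
    by apply: le_trans bn; apply: prefix_pt_close => // j; rewrite ffunE.
  have h2 : `|(a i)%:~R / q'.+1%:R - digsum R e i| <= 2 * delta / Q.
    by apply: le_trans (ltW ay); rewrite yE; exact: coord_le_supdist.
  have -> : q'.+1%:R * prefix_pt R a0 v i - (a i)%:~R =
     - q'.+1%:R * (((a i)%:~R / q'.+1%:R - digsum R e i) + (digsum R e i - prefix_pt R a0 v i)).
    by field; rewrite gt_eqF.
  rewrite normrM normrN (gtr0_norm q0).
  apply: le_trans (_ : Q * (2 * delta / Q + delta / Q) <= _); last first.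
    by rewrite le_eqVlt; apply/orP; left; apply/eqP; field; rewrite gt_eqF.
  apply: ler_pM; [by []|exact: normr_ge0|exact: qQ|exact: le_trans (ler_normD _ _) (lerD h2 h1)].
pose o : {ffun 'I_k -> 'I_7} :=
  [ffun i => int_offset 3 (q'.+1%:R * prefix_pt R a0 v i) (a i)].
exists ((v, Ordinal q'M), o).
  by rewrite !inE /= andbT; apply/andP; split; [move: vD; rewrite inE|apply/asboolP; exists a].
rewrite /f /=; congr (_, _); apply/ffunP => i; rewrite !ffunE.
rewrite -int_offsetK // distrC; apply: le_trans (near i) _; lra.
Qed.

Let c0 : R := cos (pi / 4) ^+ 4.
Let c0_gt0 : 0 < c0.
Proof.
by rewrite exprn_gt0 // cos_gt0_pihalf //; have := pi_gt0 R; lra.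
Qed.

Lemma bdd_measurable_scaled_prod N (B a : 'I_k -> R) (p : 'I_k -> R -> R) (q : nat) :
  (forall i, trig_repr N (B i) (a i) (p i)) ->
  bdd_measurable (fun w => \prod_i p i (q%:R * X w i)).
Proof. by move=> H; have [] := Ex_trig_prod b2 iid q%:Z H. Qed.

(** On the cylinder of a good pair [q X] is within [3 delta + delta] of an integer vector, the last
    [delta] for passing from the prefix point to [X]. The product of kernels is at least [c0^k]
    there, while its expectation, summed over [q], is at most [m^-k (Q + W)]. *)
Lemma count_upper n m (Q delta : R) : 1 <= Q -> 0 < delta < 1 ->
  b%:R ^- n <= delta / Q -> (0 < m)%N -> m = 1%N \/ m%:R * (4 * delta) <= 8^-1 ->
  (count_N K Q delta)%:R <= 7 ^+ k * c0 ^- k * #|D|%:R ^+ n * m%:R ^- k *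
    (Q + dilated_sum (fourier_abs P d) (Num.truncn Q) m.*2).
Proof.
move=> Q1 d01 bn m0 md; have /andP[d0 d1] := d01.
have Q0 : 0 < Q by apply: lt_le_trans Q1.
have [_ cN] := count_le_good_pairs Q1 d01 bn.
have [M0 MQ QM] := trunc_bounds Q1; set M := Num.truncn Q in M0 MQ QM cN *.
set G := good_pairs n xpredT (3 * delta) in cN.
have mR : 0 < m%:R :> R by rewrite ltr0n.
have [a ar /andP[a1 a2]] := jackson_repr R m0.
have hr (i : 'I_k) : trig_repr m.*2 m%:R^-1 a (jackson m) := ar.
set W := dilated_sum _ _ _.
have W0 : 0 <= W by apply: sumr_ge0 => q _; apply: sumr_ge0 => t _; exact: sqrtr_ge0.
have sumle : \sum_(q < M) Ex (fun w => \prod_(i < k) jackson m (q.+1%:R * X w i)) <=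
    m%:R ^- k * (Q + W).
  have := Ex_trig_prod_sum b2 iid (fun _ : 'I_M => true) hr.
  rewrite !prodr_const cardT size_enum_ord card_ord exprVn -/W.
  rewrite ler_norml => /andP[_]; rewrite lerBlDr => h.
  apply: le_trans h _; rewrite mulrDr addrC lerD2r mulrC.
  have a0' : 0 <= a by apply: le_trans a1; rewrite invr_ge0 mulr_ge0.
  apply: ler_pM; [exact: exprn_ge0|by []| |exact: MQ].
  by rewrite -exprVn lerXn2r ?nnegrE ?invr_ge0.
have Gle : c0 ^+ k * ((#|G|)%:R * #|D|%:R ^- n) <=
    \sum_(q < M) Ex (fun w => \prod_(i < k) jackson m (q.+1%:R * X w i)).
  rewrite card_good_pairs -ExZ; last first.
    exact: (bdd_measurable_prefix b2 iid (fun v => \sum_(q < M) `[< near_int (3 * delta) v q.+1 >]%:R)).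
  rewrite -Ex_sum; last by move=> q; exact: bdd_measurable_scaled_prod hr.
  apply: Ex_le.
  - apply: bdd_measurableM; first exact: bdd_measurable_cst.
    exact: (bdd_measurable_prefix b2 iid (fun v => \sum_(q < M) `[< near_int (3 * delta) v q.+1 >]%:R)).
  - by apply: bdd_measurable_sum => q; exact: bdd_measurable_scaled_prod hr.
  move=> w; rewrite mulr_sumr; apply: ler_sum => q _.
  case: asboolP => [[z zn]|_]; last by rewrite mulr0; apply: prodr_ge0 => i _; exact: jackson_ge0.
  rewrite mulr1 -[X in c0 ^+ X](card_ord k) -prodr_const; apply: ler_prod => i _.
  rewrite (ltW c0_gt0) /=; apply: (jackson_lower (a := z i)) => //.
  case: md => md; [by left|right]; apply: le_trans md; rewrite ler_pM2l //.
  have -> : q.+1%:R * X w i - (z i)%:~R = q.+1%:R * (X w i - prefix_pt R a0 (prefix d n w) i) +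
     (q.+1%:R * prefix_pt R a0 (prefix d n w) i - (z i)%:~R) by ring.
  apply: le_trans (ler_normD _ _) _.
  rewrite (_ : 4 * delta = delta + 3 * delta); last by ring.
  apply: lerD; last exact: zn.
  rewrite normrM normr_nat.
  apply: le_trans (_ : Q * (delta / Q) <= _); last by rewrite mulrC divfK // gt_eqF.
  apply: ler_pM => //.
    by apply: le_trans MQ; rewrite ler_nat.
  by apply: le_trans bn; apply: prefix_pt_close => // j; rewrite ffunE.
have {Gle}Gle := le_trans Gle sumle.
have cD : 0 < c0 ^+ k * #|D|%:R ^- n.
  by apply: mulr_gt0; [exact: exprn_gt0|rewrite invr_gt0 exprn_gt0].
have G2 : (#|G|)%:R <= c0 ^- k * #|D|%:R ^+ n * (m%:R ^- k * (Q + W)).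
  rewrite -(ler_pM2l cD); apply: le_trans (_ : m%:R ^- k * (Q + W) <= _).
    by apply: le_trans Gle; rewrite le_eqVlt; apply/orP; left; apply/eqP; ring.
  have u0 : c0 ^+ k != 0 by rewrite gt_eqF // exprn_gt0.
  have v0 : #|D|%:R ^+ n != 0 :> R by rewrite gt_eqF // exprn_gt0.
  have w0 : m%:R ^+ k != 0 :> R by rewrite gt_eqF // exprn_gt0.
  rewrite le_eqVlt; apply/orP; left; apply/eqP; field.
  by rewrite u0 v0 w0.
apply: le_trans (_ : (#|G| * 7 ^ k)%:R <= _); first by rewrite ler_nat.
rewrite natrM natrX mulrC; apply: le_trans (ler_wpM2l _ G2) _; first by rewrite exprn_ge0.
by rewrite !mulrA.
Qed.

(** With denominator at least [Q / 2], the window [delta / 2] before dividing becomes [delta / Q]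
    after. Different words may yield the same [a / q], but their points then lie within [4 b] times
    [b^-n] of it, so the fibers are bounded. *)
Lemma good_pairs_le_count n (Q delta : R) (S : pred 'I_(Num.truncn Q)) :
  1 <= Q -> 0 < delta < 1 ->
  b%:R ^- n <= delta / Q -> delta / Q <= 4 * b%:R * b%:R ^- n ->
  (forall q, S q -> Q <= 2 * q.+1%:R) ->
  (#|good_pairs n S (delta / 2)| <= count_N K Q delta * ((4 * b).+1.*2.+1 ^ k))%N.
Proof.
move=> Q1 d01 bn bn2 SQ; have /andP[d0 d1] := d01.
have Q0 : 0 < Q by apply: lt_le_trans Q1.
have [fN _] := count_le_good_pairs Q1 d01 bn.
have [M0 MQ QM] := trunc_bounds Q1; set M := Num.truncn Q in S M0 MQ QM SQ *.
have pickP (vq : {ffun 'I_n -> digit k b} * 'I_M) : exists a : {ffun 'I_k -> int},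
    vq \in good_pairs n S (delta / 2) ->
    forall i, `|vq.2.+1%:R * prefix_pt R a0 vq.1 i - (a i)%:~R| <= delta / 2.
  case: (boolP (vq \in _)) => [|_]; last by exists [ffun=> 0].
  by rewrite inE => /and3P[_ _ /asboolP[a Ha]]; exists a.
have [A HA] := choice pickP.
have near vq : vq \in good_pairs n S (delta / 2) ->
    forall i, `|(A vq i)%:~R / vq.2.+1%:R - prefix_pt R a0 vq.1 i| <= delta / Q.
  move=> vqG i; have q0 : 0 < vq.2.+1%:R :> R by [].
  have Sq : S vq.2 by move: vqG; rewrite inE => /and3P[].
  have -> : (A vq i)%:~R / vq.2.+1%:R - prefix_pt R a0 vq.1 i =
     - (vq.2.+1%:R * prefix_pt R a0 vq.1 i - (A vq i)%:~R) / vq.2.+1%:R.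
    by field; rewrite gt_eqF.
  rewrite normrM normfV normrN (gtr0_norm q0) ler_pdivrMr //.
  apply: le_trans (HA vq vqG i) _.
  apply: le_trans (_ : delta / Q * (Q / 2) <= _).
    by rewrite le_eqVlt; apply/orP; left; apply/eqP; field; rewrite gt_eqF.
  rewrite ler_pM2l ?divr_gt0 //; have := SQ _ Sq; lra.
pose h (vq : {ffun 'I_n -> digit k b} * 'I_M) : {ffun 'I_k -> int} * int :=
  (A vq, vq.2.+1%:Z).
apply: (@card_fibers _ _ _ h).
  move=> vq vqG; rewrite in_fset_set //; apply/mem_set; split => //=; split.
    by rewrite -pmulrn; apply: le_trans MQ; rewrite ler_nat.
  have vD : vq.1 \in D_words D n by move: vqG; rewrite !inE => /and3P[].
  apply: le_trans (setdist_le _ (prefix_pt_fractal R a0D vD)) _.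
  apply: supdist_le; first by rewrite divr_ge0 // ltW.
  by move=> i; rewrite -pmulrn; exact: near.
move=> [a q]; set F := [set _ in _ | _]%SET.
rewrite -(@card_in_imset _ _ fst F); last first.
  move=> [v1 q1] [v2 q2]; rewrite !inE /h /= => /andP[_ /eqP[_ e1]] /andP[_ /eqP[_ e2]] ->.
  by congr (_, _); apply: val_inj => /=; move: e1; rewrite -e2 => -[].
apply: (@card_digits_near R _ _ b2 a0 _ (fun i => (a i)%:~R / q%:~R)) => v.
move=> /imsetP[vq]; rewrite inE => /andP[vqG /eqP[<- <-]] -> i.
rewrite distrC natrM -pmulrn; exact: le_trans (near vq vqG i) bn2.
Qed.

(* Nonpositive as soon as some [y i] is at distance at least [e] from the integers. *)
Definition minorant m (e : R) (y : 'I_k -> R) : R :=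
  \prod_i jackson m (y i) -
  (4 * e ^+ 2)^-1 * \sum_i \prod_j (if j == i then jackson_defect m else jackson m) (y j).

Lemma minorant_factor m e y : minorant m e y =
  (\prod_i jackson m (y i)) * (1 - (4 * e ^+ 2)^-1 * \sum_i (1 - cos (2 * pi * y i))).
Proof.
rewrite /minorant mulrBr mulr1; congr (_ - _); rewrite [RHS]mulrCA; congr (_ * _).
rewrite [RHS]mulr_sumr; apply: eq_bigr => i _.
rewrite (bigD1 i) //= eqxx [in RHS](bigD1 i) //= /jackson_defect.
rewrite (eq_bigr (fun j => jackson m (y j))); first by ring.
by move=> j /negbTE ->.
Qed.

(** In factored form the second factor is at most [1], and it is nonpositive once some
    [1 - cos (2 pi y_i)] reaches [4 e^2], which happens when [y_i] is at distance at least [e] from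
    the integers. *)
Lemma minorant_le m e y : (0 < m)%N -> 0 < e ->
  minorant m e y <= `[< exists a : {ffun 'I_k -> int}, forall i, `|y i - (a i)%:~R| < e >]%:R.
Proof.
move=> m0 e0; rewrite minorant_factor.
have e4 : 0 < 4 * e ^+ 2 by rewrite mulr_gt0 // exprn_gt0.
have p0 : 0 <= \prod_i jackson m (y i) by apply: prodr_ge0 => i _; exact: jackson_ge0.
have p1 : \prod_i jackson m (y i) <= 1.
  by apply: prodr_ile1 => i _; rewrite jackson_ge0 jackson_le1.
have s0 i : 0 <= 1 - cos (2 * pi * y i) by rewrite subr_ge0 cos_le1.
case: asboolP => [_|H].
  apply: le_trans (_ : \prod_i jackson m (y i) * 1 <= _); last by rewrite mulr1.
  by rewrite ler_wpM2l // gerBl mulr_ge0 ?invr_ge0 ?(ltW e4) // sumr_ge0.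
rewrite mulr_ge0_le0 // subr_le0.
have [i yi] : exists i, 4 * e ^+ 2 <= 1 - cos (2 * pi * y i).
  apply: contrapT => /forallNP Hn; apply: H.
  have /choice[a Ha] : forall i, exists a : int, `|y i - a%:~R| < e.
    by move=> i; apply: near_int_of_cos => //; rewrite ltNge; apply/negP/Hn.
  by exists [ffun i => a i] => i; rewrite ffunE.
rewrite mulrC ler_pdivlMr // mul1r; apply: le_trans yi _.
by rewrite (bigD1 i) //= lerDl sumr_ge0.
Qed.

Let jackson_family m i j (a : R) : (0 < m)%N -> trig_repr m.*2 m%:R^-1 a (jackson m) ->
  trig_repr m.*2 (if j == i :> 'I_k then 2 / m%:R ^+ 3 else m%:R^-1)
    (if j == i then m%:R ^- 3 else a) (if j == i then jackson_defect m else jackson m).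
Proof. by move=> m0 ar; case: (j == i); [exact: jackson_defect_repr|exact: ar]. Qed.

Lemma bdd_measurable_minorant m e q : (0 < m)%N ->
  bdd_measurable (fun w => minorant m e (fun i => q%:R * X w i)).
Proof.
move=> m0; have [a ar _] := jackson_repr R m0.
apply: bdd_measurableD; first exact: (bdd_measurable_scaled_prod q (fun=> ar)).
under eq_fun do rewrite -mulNr.
apply: bdd_measurableM; first exact: bdd_measurable_cst.
by apply: bdd_measurable_sum => i; exact: (bdd_measurable_scaled_prod q (fun j => jackson_family i j m0 ar)).
Qed.

(** The minorant has mean at least [a^(k-1) (a - 1 / (4 m))], and [a >= 1 / (2 m)] leaves
    [(4 m)^-k]. The error of the first product is [m^-k W], that of the subtracted terms half as
    much; the factor [2] covers both. *)
Lemma Ex_minorant_ge M m (S : pred 'I_M) (e : R) : (0 < k)%N -> (0 < m)%N -> 0 < e ->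
  k%:R <= m%:R * e ->
  m%:R ^- k * (4 ^- k * (#|S|)%:R - 2 * dilated_sum (fourier_abs P d) M m.*2) <=
  \sum_(q < M | S q) Ex (fun w => minorant m e (fun i => q.+1%:R * X w i)).
Proof.
move=> k0 m0 e0 kme; have mR : 0 < m%:R :> R by rewrite ltr0n.
set W := dilated_sum _ _ _; set s := (#|S|)%:R.
have W0 : 0 <= W by apply: sumr_ge0 => q _; apply: sumr_ge0 => t _; exact: sqrtr_ge0.
have s0 : 0 <= s by [].
have kR : 1 <= k%:R :> R by rewrite ler1n.
have e4 : 0 < 4 * e ^+ 2 by rewrite mulr_gt0 // exprn_gt0.
have [a ar /andP[a1 a2]] := jackson_repr R m0.
have a0' : 0 < a by apply: lt_le_trans a1; rewrite invr_gt0 mulr_gt0.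
have hr (i : 'I_k) : trig_repr m.*2 m%:R^-1 a (jackson m) := ar.
have hr2 (i j : 'I_k) := jackson_family i j m0 ar.
have prodif (i : 'I_k) (x y : R) : \prod_(j < k) (if j == i then x else y) = x * y ^+ k.-1.
  rewrite (bigD1 i) //= eqxx; congr (_ * _).
  rewrite (eq_bigr (fun=> y)); last by move=> j /negbTE ->.
  by rewrite prodr_const cardC1 card_ord.
have h1 : s * a ^+ k - m%:R ^- k * W <=
    \sum_(q < M | S q) Ex (fun w => \prod_(i < k) jackson m (q.+1%:R * X w i)).
  have := Ex_trig_prod_sum b2 iid S hr.
  rewrite !prodr_const card_ord exprVn -/W -/s ler_norml => /andP[+ _].
  by rewrite lerBrDr addrC.
have h2 i : \sum_(q < M | S q) Ex (fun w =>
      \prod_(j < k) (if j == i then jackson_defect m else jackson m) (q.+1%:R * X w j)) <=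
    s * (m%:R ^- 3 * a ^+ k.-1) + 2 / m%:R ^+ 3 * m%:R^-1 ^+ k.-1 * W.
  have := Ex_trig_prod_sum b2 iid S (hr2 i).
  by rewrite !prodif -/W -/s ler_norml => /andP[_]; rewrite lerBlDr addrC.
have split_q q : Ex (fun w => minorant m e (fun i => q.+1%:R * X w i)) =
    Ex (fun w => \prod_(i < k) jackson m (q.+1%:R * X w i)) - (4 * e ^+ 2)^-1 *
    \sum_(i < k) Ex (fun w => \prod_(j < k) (if j == i then jackson_defect m else jackson m) (q.+1%:R * X w j)).
  have bm1 := bdd_measurable_scaled_prod q.+1 hr.
  have bm2 i := bdd_measurable_scaled_prod q.+1 (hr2 i).
  have bm3 := @bdd_measurable_sum _ _ _ _ (index_enum 'I_k) xpredT _ bm2.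
  rewrite /minorant RintegralB //.
  - by rewrite ExZ // Ex_sum.
  - exact: bdd_measurable_integrable.
  - apply: bdd_measurable_integrable; apply: bdd_measurableM => //.
    exact: bdd_measurable_cst.
under [leRHS]eq_bigr do rewrite split_q.
rewrite sumrB -mulr_sumr exchange_big /=.
have h3 : \sum_(i < k) \sum_(q < M | S q) Ex (fun w =>
      \prod_(j < k) (if j == i then jackson_defect m else jackson m) (q.+1%:R * X w j)) <=
    k%:R * (s * (m%:R ^- 3 * a ^+ k.-1) + 2 / m%:R ^+ 3 * m%:R^-1 ^+ k.-1 * W).
  apply: le_trans (ler_sum _ (fun i _ => h2 i)) _.
  by rewrite sumr_const card_ord [leRHS]mulr_natl.
apply: le_trans (lerB h1 (ler_wpM2l _ h3)); last by rewrite invr_ge0 ltW.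
(* [k / (4 e^2 m^3) <= 1 / (4 m)] because [k <= k^2 <= (m e)^2] *)
have key : (4 * e ^+ 2)^-1 * k%:R * m%:R ^- 3 <= 4^-1 * m%:R^-1.
  have -> : (4 * e ^+ 2)^-1 * k%:R * m%:R ^- 3 = (4^-1 * m%:R^-1) * (k%:R / (m%:R * e) ^+ 2).
    by field; rewrite (gt_eqF mR) (gt_eqF e0).
  apply: ler_piMr; first by rewrite mulr_ge0 ?invr_ge0.
  rewrite ler_pdivrMr ?exprn_gt0 ?mulr_gt0 // mul1r.
  apply: le_trans (_ : k%:R ^+ 2 <= _); first by rewrite expr2 ler_peMl.
  have me0 : 0 <= m%:R * e by rewrite mulr_ge0 // ltW.
  by rewrite lerXn2r ?nnegrE.
have ak : a ^+ k = a * a ^+ k.-1 by rewrite -exprS prednK.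
have mk : m%:R ^- k = m%:R^-1 * m%:R^-1 ^+ k.-1 :> R by rewrite -exprVn -exprS prednK.
have ap : 0 <= a ^+ k.-1 by rewrite exprn_ge0 // ltW.
have mp : 0 <= m%:R^-1 ^+ k.-1 :> R by rewrite exprn_ge0 // invr_ge0.
have low : 4 ^- k * m%:R ^- k <= (a - 4^-1 * m%:R^-1) * a ^+ k.-1.
  have -> : 4 ^- k * m%:R ^- k = (4^-1 * m%:R^-1) * (4^-1 * m%:R^-1) ^+ k.-1 :> R.
    by rewrite -exprS prednK // -!exprVn exprMn.
  have i0 : 0 <= m%:R^-1 :> R by rewrite invr_ge0.
  rewrite invfM in a1.
  apply: ler_pM; [by rewrite mulr_ge0|by rewrite exprn_ge0 // mulr_ge0|lra|].
  by rewrite lerXn2r ?nnegrE ?mulr_ge0 ?(ltW a0') //; lra.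
set u := (4 * e ^+ 2)^-1 in key *; set x := m%:R ^- 3 in key *.
rewrite ak mk.
rewrite mk in low.
set A := a ^+ k.-1 in ap low *; set B := m%:R^-1 ^+ k.-1 in mp low *.
set i := m%:R^-1 in key low *.
have t1 : u * k%:R * x * (s * A) <= 4^-1 * i * (s * A) by rewrite ler_wpM2r // mulr_ge0.
have t2 : u * k%:R * x * (2 * B * W) <= 4^-1 * i * (2 * B * W).
  by rewrite ler_wpM2r // !mulr_ge0.
have t3 := ler_wpM2l s0 low.
have i0 : 0 <= i by rewrite invr_ge0.
have t4 : 0 <= i * B * W by rewrite !mulr_ge0.
lra.
Qed.

(** The window [delta / 2] is shared equally: [delta / 4] for the minorant at [q X], and [delta / 4]
    for passing to the prefix point, which dictates [b^-n <= delta / (4 Q)]. *)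
Lemma count_lower n m (Q delta : R) : (0 < k)%N -> 1 <= Q -> 0 < delta < 1 ->
  b%:R ^- n <= delta / (4 * Q) -> delta / (4 * Q) < b%:R * b%:R ^- n ->
  (0 < m)%N -> k%:R <= m%:R * (delta / 4) ->
  #|D|%:R ^+ n * m%:R ^- k *
    (4 ^- k * (Q / 4) - 2 * dilated_sum (fourier_abs P d) (Num.truncn Q) m.*2) <=
  (count_N K Q delta)%:R * ((4 * b).+1.*2.+1 ^ k)%:R.
Proof.
move=> k0 Q1 d01 bn bn2 m0 km; have /andP[d0 d1] := d01.
have Q0 : 0 < Q by apply: lt_le_trans Q1.
have [M0 MQ QM] := trunc_bounds Q1; set M := Num.truncn Q in M0 MQ QM *.
have dQ : delta / (4 * Q) = 4^-1 * (delta / Q) by field; rewrite gt_eqF.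
have dQ0 : 0 < delta / Q by rewrite divr_gt0.
pose S : pred 'I_M := fun q => (M < 2 * q.+1)%N.
have SQ q : S q -> Q <= 2 * q.+1%:R.
  by rewrite /S -(ler_nat R) -[M.+1%:R]natr1 natrM => h; apply: le_trans (ltW QM) h.
(* At least half of the denominators up to [M] are kept, and [Q < M + 1 <= 2 M]. *)
have cS : Q / 4 <= (#|S|)%:R.
  have : (M <= 2 * #|S|)%N by exact: card_upper_half.
  rewrite -(ler_nat R) natrM => h.
  have : 1 <= M%:R :> R by rewrite ler1n.
  lra.
have GN : (#|good_pairs n S (delta / 2)|%:R : R) <=
    (count_N K Q delta)%:R * ((4 * b).+1.*2.+1 ^ k)%:R.
  rewrite -natrM ler_nat; apply: good_pairs_le_count => //.
    by apply: le_trans bn _; rewrite dQ; lra.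
  by rewrite -mulrA; move: (ltW bn2); rewrite dQ; set z := _ * b%:R ^- n; lra.
apply: le_trans GN.
have d4 : 0 < delta / 4 by rewrite divr_gt0.
have low := Ex_minorant_ge S k0 m0 d4 km.
have up : \sum_(q < M | S q) Ex (fun w => minorant m (delta / 4) (fun i => q.+1%:R * X w i)) <=
    (#|good_pairs n S (delta / 2)|)%:R * #|D|%:R ^- n.
  rewrite card_good_pairs -Ex_sum; last by move=> q; exact: bdd_measurable_minorant.
  apply: Ex_le.
  - by apply: bdd_measurable_sum => q; exact: bdd_measurable_minorant.
  - exact: (bdd_measurable_prefix b2 iid
      (fun v => \sum_(q < M | S q) `[< near_int (delta / 2) v q.+1 >]%:R)).
  move=> w; apply: ler_sum => q _; apply: le_trans (minorant_le _ m0 d4) _.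
  rewrite ler_nat; case: asboolP => [[a Ha]|//]; rewrite asboolT //; exists a => i.
  have -> : q.+1%:R * prefix_pt R a0 (prefix d n w) i - (a i)%:~R =
     (q.+1%:R * X w i - (a i)%:~R) - q.+1%:R * (X w i - prefix_pt R a0 (prefix d n w) i) by ring.
  apply: le_trans (ler_normB _ _) _.
  rewrite (_ : delta / 2 = delta / 4 + Q * (delta / (4 * Q))); last first.
    by field; rewrite gt_eqF.
  apply: lerD; first exact: ltW (Ha i).
  rewrite normrM normr_nat; apply: ler_pM => //.
    by apply: le_trans MQ; rewrite ler_nat.
  by apply: le_trans bn; apply: prefix_pt_close => // j; rewrite ffunE.
have DnR : 0 < #|D|%:R ^+ n :> R by rewrite exprn_gt0.
rewrite -mulrA mulrC -ler_pdivlMr //.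
apply: le_trans up; apply: le_trans low.
by rewrite ler_wpM2l ?invr_ge0 ?exprn_ge0 // lerD2r ler_wpM2l ?invr_ge0 ?exprn_ge0.
Qed.

End Counting.

(** * Consequences of properness, and the choice of kernel lengths *)

Lemma proper_fractal_k_gt0 (R : realType) k (K : set ('I_k -> R)) :
  proper_fractal K -> (0 < k)%N.
Proof.
case: k K => // K [[x [y [_ [_ xy]]]] _]; case: xy.
by apply/funext => -[].
Qed.

Lemma proper_fractal_card_gt1 (R : realType) k b (D : {set digit k b}) :
  proper_fractal (@missing_digit_fractal R k b D) -> (2 <= #|D|)%N.
Proof.
move=> [[x [y [[d [dD ->]] [[e [eD ->]] xy]]]] _]; rewrite ltnNge; apply/negP.
move=> /card_le1_eqP H; apply: xy; congr (digsum R).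
by apply/funext => j; exact: H.
Qed.

(** Puts the main term in the shape in which it arises: number of words, times probability
    [delta^k], times number of denominators. *)
Lemma powR_ratio (R : realType) (k : nat) (kap delta Q : R) : 0 < delta -> 0 < Q ->
  delta `^ (k%:R - kap) * Q `^ (kap + 1) = (Q / delta) `^ kap * (delta ^+ k * Q).
Proof.
move=> d0 Q0; have dn := lt0r_neq0 d0; have Qn := lt0r_neq0 Q0.
rewrite powRB ?dn ?implybT // powRD ?Qn ?implybT // powR_mulrn ?(ltW d0) //.
rewrite powRr1 ?(ltW Q0) // powRM ?invr_ge0 ?(ltW d0) ?(ltW Q0) // powRV ?(ltW d0) //.
by ring.
Qed.

(** The natural choice is the integer part of [1 / (32 delta)], so that [4 m delta <= 1/8]; for
    [delta > 1/32] it is [0], and the constant kernel [m = 1] takes over. *)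
Lemma upper_kernel_length (R : realType) (delta : R) : 0 < delta < 1 ->
  exists m : nat, [/\ (0 < m)%N, m = 1%N \/ m%:R * (4 * delta) <= 8^-1,
    m%:R^-1 <= 64 * delta & m%:R <= delta^-1].
Proof.
move=> /andP[d0 d1]; have d0' : delta != 0 by rewrite gt_eqF.
have i1 : 1 <= delta^-1 by rewrite invf_ge1 // ltW.
pose z := (32 * delta)^-1.
have zd : z * delta = 32^-1 by rewrite /z invfM mulfVK.
have z0 : 0 < z by rewrite invr_gt0 mulr_gt0.
have [z1|z1] := ltP z 1.
  exists 1%N; split => //; [by left|]; rewrite invr1.
  have : z * delta < delta by rewrite gtr_pMl.
  by rewrite zd; lra.
have [m0 mz zm] := trunc_bounds z1; set m := Num.truncn z in m0 mz zm.
have m1 : 1 <= m%:R :> R by rewrite ler1n.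
exists m; split => //.
- right; have := ler_wpM2r (ltW d0) mz; rewrite zd; lra.
- rewrite -[leLHS]mul1r ler_pdivrMr; last by rewrite ltr0n.
  have : z * delta <= (2 * m%:R) * delta by rewrite ler_pM2r //; lra.
  by rewrite zd; lra.
- apply: le_trans mz _; rewrite /z invfM mulrC.
  by apply: ler_piMr => //; rewrite ?invr_ge0 ?(ltW d0) // invf_le1 // ler1n.
Qed.

Lemma lower_kernel_length (R : realType) (k : nat) (delta : R) : (0 < k)%N -> 0 < delta < 1 ->
  exists m : nat, [/\ (0 < m)%N, k%:R <= m%:R * (delta / 4) & m%:R <= 5 * k%:R / delta].
Proof.
move=> k0 /andP[d0 d1]; have k1 : 1 <= k%:R :> R by rewrite ler1n.
pose z := 4 * k%:R / delta; have z0 : 0 <= z by rewrite divr_ge0 ?mulr_ge0 // ltW.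
have zd : z * delta = 4 * k%:R by rewrite /z divfK // gt_eqF.
exists (Num.truncn z).+1; split => //.
  have := ltW (truncnS_gt z); set m := _.+1%:R => h.
  by have := ler_wpM2r (ltW d0) h; rewrite zd; lra.
have h : (Num.truncn z)%:R <= z by rewrite truncn_le.
rewrite -[(Num.truncn z).+1%:R]natr1; apply: le_trans (lerD h (lexx 1)) _.
rewrite ler_pdivlMr // mulrDl zd mul1r; lra.
Qed.

(** * The error term and the final constants *)

Section Assembly.
Variables (R : realType) (k b : nat) (D : {set digit k b}).
Hypothesis b2 : (2 <= b)%N.
Hypothesis D2 : (2 <= #|D|)%N.
Hypothesis k0 : (0 < k)%N.
Local Notation K := (@missing_digit_fractal R k b D).
Variables (dsp : measure_display) (Omega : measurableType dsp) (P : probability Omega R).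
Variable d : nat -> Omega -> digit k b.
Hypothesis iid : iid_uniform_digits P D d.
Local Notation kap := (@simdim R k b D).
Local Notation W := (dilated_sum (fourier_abs P d)).

Let kR : 1 <= k%:R :> R. Proof. by rewrite ler1n. Qed.
Let bR : 0 < b%:R :> R. Proof. by rewrite ltr0n (ltn_trans _ b2). Qed.

Lemma dilated_sum_exponent :
  k%:R - k%:R / (k.+1)%:R < dim_l1 (fourier_abs P d) ->
  exists th C : R, [/\ 0 < th, th < k%:R / (k.+1)%:R, 0 < C &
    forall M N, (0 < M)%N -> (0 < N)%N -> W M N <= C * (M * N)%:R `^ th].
Proof.
move=> hdim; have kk0 : 0 < k%:R / k.+1%:R :> R by rewrite divr_gt0 // ltr0n.
have [s [s0 [C HC]] ks] : exists2 s : R, (0 <= s /\ exists C : R, forall Q : R, 1 <= Q ->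
          box_sum Q (fourier_abs P d) <= C * Q `^ (k%:R - s)) & k%:R - k%:R / (k.+1)%:R < s.
  apply: (sup_gt _ hdim).
  (* The supremum of the empty set is [0], which cannot exceed the nonnegative threshold, so the set
     is nonempty. *)
  apply: contrapT => /nonemptyPn E0; move: hdim; rewrite /dim_l1 E0 sup0.
  apply/negP; rewrite -leNgt subr_ge0 ler_pdivrMr ?ltr0n // ler_peMr //.
  by rewrite ler1n.
(* An admissible [s] could a priori exceed [k]; clamping at [0] makes the midpoint of [t] and
   [k / (k + 1)] a positive exponent. *)
pose t := Num.max (k%:R - s) 0.
have t1 : k%:R - s <= t by rewrite le_max lexx.
have t2 : 0 <= t by rewrite le_max lexx orbT.
have t3 : t < k%:R / k.+1%:R by rewrite gt_max kk0 andbT ltrBlDr -ltrBlDl.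
move: t3 kk0; set x := k%:R / _ => t3 kk0.
have [||C' C'0 HC'] := @dilated_sum_bound R k (fourier_abs P d) C (k%:R - s) ((t + x) / 2) _ HC.
- by move=> y; exact: sqrtr_ge0.
- by lra.
by exists ((t + x) / 2), C'; split => //; lra.
Qed.

(** Here the range of [delta] enters: [N <= A / delta] gives [M N <= (A / c) Q^(1 + 1/k + eta)] with
    [M] the integer part of [Q]. *)
Lemma dilated_sum_small (th C eta c A : R) : 0 < th -> 0 < C -> 0 < c -> 0 < A ->
  (forall M N, (0 < M)%N -> (0 < N)%N -> W M N <= C * (M * N)%:R `^ th) ->
  forall (Q delta : R) (N : nat), 1 <= Q -> 0 < delta ->
  c * Q `^ (- eta - k%:R^-1) <= delta -> (0 < N)%N -> N%:R <= A / delta ->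
  W (Num.truncn Q) N <= C * (A / c) `^ th * Q `^ (th * (1 + k%:R^-1 + eta)).
Proof.
move=> th0 C0 c0 A0 HW Q delta N Q1 d0 cd N0 NA.
have Q0 : 0 < Q by apply: lt_le_trans Q1.
have [M0 MQ _] := trunc_bounds Q1.
apply: le_trans (HW _ _ M0 N0) _; rewrite -mulrA ler_wpM2l ?(ltW C0) //.
apply: le_trans (_ : (A / c * Q `^ (1 + k%:R^-1 + eta)) `^ th <= _); last first.
  by rewrite powRM ?powR_ge0 ?divr_ge0 ?(ltW A0) ?(ltW c0) // -powRrM [_ * th]mulrC.
apply: powR_le; rewrite ?(ltW th0) // natrM.
apply: le_trans (_ : Q * (A / delta) <= _); first by apply: ler_pM.
have q0 : 0 < c * Q `^ (- eta - k%:R^-1) by rewrite mulr_gt0 // powR_gt0.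
apply: le_trans (_ : Q * (A / (c * Q `^ (- eta - k%:R^-1))) <= _).
  by rewrite ler_pM2l // ler_pM2l // lef_pV2 ?posrE.
have -> : - eta - k%:R^-1 = - (k%:R^-1 + eta) by ring.
rewrite powRN -addrA [Q `^ (1 + _)]powRD ?(lt0r_neq0 Q0) ?implybT // powRr1 ?(ltW Q0) //.
set u := Q `^ (_ + _); have u0 : 0 < u by rewrite powR_gt0.
by rewrite le_eqVlt; apply/orP; left; apply/eqP; field; rewrite (gt_eqF c0) (gt_eqF u0).
Qed.

(** One level [n] serves both bounds. The bound [10 k / delta] covers the degrees [2 m] of both
    kernels, and [4^-k / 32] makes [2 W] at most a quarter of the main term [4^-k Q / 4] of the
    lower bound. *)
Lemma counting_from_small_error (Q delta : R) : 1 <= Q -> 0 < delta < 1 ->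
  (forall N, (0 < N)%N -> N%:R <= 10 * k%:R / delta ->
     W (Num.truncn Q) N <= 4 ^- k / 32 * Q) ->
  (5 * k%:R) ^- k * 4 ^- k / 8 / ((4 * b).+1.*2.+1 ^ k)%:R *
     (delta `^ (k%:R - kap) * Q `^ (kap + 1)) <= (count_N K Q delta)%:R /\
  (count_N K Q delta)%:R <= 7 ^+ k * (cos (pi / 4) ^+ 4) ^- k * (4 * b%:R) `^ kap * 64 ^+ k * 2 *
     (delta `^ (k%:R - kap) * Q `^ (kap + 1)).
Proof.
move=> Q1 d01 HW; have /andP[d0 d1] := d01.
have Q0 : 0 < Q by apply: lt_le_trans Q1.
have /card_gt0P[a0 a0D] : (0 < #|D|)%N by apply: ltn_trans D2.
have kap0 := simdim_gt0 R b2 D2.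
have Qd0 : 0 < Q / delta by rewrite divr_gt0.
have dQ0 : 0 < delta / Q by rewrite divr_gt0.
have [n [n1 n2]] : exists n, b%:R ^- n <= delta / (4 * Q) /\ delta / (4 * Q) < b%:R * b%:R ^- n.
  apply: base_power_between => //; rewrite divr_gt0 ?mulr_gt0 //=.
  by rewrite ler_pdivrMr ?mulr_gt0 // mul1r; lra.
have bn : 0 < b%:R ^+ n :> R by rewrite exprn_gt0.
have n1' : b%:R ^- n <= delta / Q.
  apply: le_trans n1 _; rewrite (_ : delta / (4 * Q) = 4^-1 * (delta / Q)); last first.
    by field; rewrite gt_eqF.
  lra.
have D1 : (Q / delta) `^ kap <= #|D|%:R ^+ n.
  rewrite -(powR_simdimXn R b2 D2); apply: powR_le; rewrite ?(ltW kap0) ?(ltW Qd0) //.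
  by rewrite -invf_div -[leRHS]invrK lef_pV2 ?posrE ?invr_gt0.
have D2' : #|D|%:R ^+ n <= (4 * b%:R) `^ kap * (Q / delta) `^ kap.
  have b4 : 0 <= 4 * b%:R :> R by rewrite mulr_ge0.
  rewrite -(powRM _ b4 (ltW Qd0)) -(powR_simdimXn R b2 D2).
  apply: powR_le; rewrite ?(ltW kap0) ?(ltW bn) //.
  have : delta / (4 * Q) * b%:R ^+ n <= b%:R.
    by rewrite -ler_pdivlMr // ltW.
  rewrite -ler_pdivlMl ?divr_gt0 ?mulr_gt0 // => h; apply: le_trans h _.
  by rewrite le_eqVlt; apply/orP; left; apply/eqP; field; rewrite (gt_eqF d0) (gt_eqF Q0).
have p4 : 0 < 4 ^- k :> R by rewrite invr_gt0 exprn_gt0.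
have p41 : 4 ^- k <= 1 :> R by rewrite invf_le1 ?exprn_gt0 // exprn_ege1 // ler1n.
have kd : 1 <= k%:R / delta by rewrite ler_pdivlMr // mul1r (le_trans (ltW d1)).
rewrite powR_ratio //; split.
  have [m [m0 km m5]] := lower_kernel_length k0 d01.
  have mR : 0 < m%:R :> R by rewrite ltr0n.
  have := count_lower b2 a0D iid k0 Q1 d01 n1 n2 m0 km.
  have m2 : (m.*2)%:R <= 10 * k%:R / delta :> R.
    by rewrite -mul2n natrM; move: m5; rewrite -!mulrA; lra.
  have := HW m.*2 _ m2; rewrite double_gt0 => /(_ m0); set w := W _ _ => wle.
  set B := (_ ^ k)%:R; have B0 : 0 < B :> R by rewrite ltr0n expn_gt0.
  rewrite -ler_pdivrMr // => /(le_trans _); apply.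
  rewrite mulrAC ler_pM2r ?invr_gt0 //.
  apply: le_trans (_ : (Q / delta) `^ kap * (delta / (5 * k%:R)) ^+ k * (4 ^- k / 8 * Q) <= _).
    rewrite le_eqVlt; apply/orP; left; apply/eqP; rewrite expr_div_n.
    have k5 : 0 < 5 * k%:R :> R by rewrite mulr_gt0 // (lt_le_trans _ kR).
    by field; apply/andP; split; rewrite gt_eqF // exprn_gt0.
  apply: ler_pM.
  - by rewrite mulr_ge0 ?powR_ge0 // exprn_ge0 // divr_ge0 ?mulr_ge0 // ltW.
  - by rewrite !mulr_ge0 // ltW.
  - apply: ler_pM => //; first exact: powR_ge0.
      by rewrite exprn_ge0 // divr_ge0 ?mulr_ge0 // ltW.
    rewrite -exprVn lerXn2r ?nnegrE ?invr_ge0 ?divr_ge0 ?mulr_ge0 ?(ltW d0) //.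
    rewrite -[leLHS]invrK invf_div lef_pV2 ?posrE // divr_gt0 ?mulr_gt0 //.
    exact: lt_le_trans kR.
  - have pQ : 0 <= 4 ^- k * Q by rewrite mulr_ge0 // ltW.
    by move: wle pQ; set p := 4 ^- k; lra.
have [m [m0 mor m64 md]] := upper_kernel_length d01.
have mR : 0 < m%:R :> R by rewrite ltr0n.
have m2 : (m.*2)%:R <= 10 * k%:R / delta :> R.
  rewrite -mul2n natrM; have : delta^-1 <= k%:R / delta by rewrite ler_peMl // invr_ge0 ltW.
  by rewrite -mulrA; lra.
have := count_upper b2 a0D iid Q1 d01 n1' m0 mor.
have := HW m.*2 _ m2; rewrite double_gt0 => /(_ m0); set w := W _ _ => wle.
set c7 := 7 ^+ k * _; have c70 : 0 <= c7.
  by rewrite mulr_ge0 ?invr_ge0 ?exprn_ge0 // cos_ge0_pihalf //; have := pi_gt0 R; lra.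
move=> /le_trans; apply.
apply: le_trans (_ : c7 * ((4 * b%:R) `^ kap * (Q / delta) `^ kap) * (64 * delta) ^+ k * (2 * Q) <= _);
  last first.
  by rewrite le_eqVlt; apply/orP; left; apply/eqP; rewrite exprMn; ring.
have w0 : 0 <= w by apply: sumr_ge0 => q _; apply: sumr_ge0 => t _; exact: sqrtr_ge0.
apply: ler_pM.
- by apply: mulr_ge0; [rewrite mulr_ge0 // exprn_ge0|rewrite invr_ge0 exprn_ge0].
- by rewrite addr_ge0 // ltW.
- apply: ler_pM; [by rewrite mulr_ge0 ?exprn_ge0|by rewrite invr_ge0 exprn_ge0|exact: ler_wpM2l|].
  by rewrite -exprVn lerXn2r ?nnegrE ?invr_ge0 ?mulr_ge0 ?(ltW d0).
- have : 4 ^- k / 32 * Q <= 1 * Q by rewrite ler_pM2r //; lra.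
  lra.
Qed.

End Assembly.

Theorem theorem1p12 (R : realType) (k b : nat) (D : {set digit k b}) :
  (2 <= b)%N -> (0 < #|D|)%N ->
  proper_fractal (@missing_digit_fractal R k b D) ->
  (exists (dsp : measure_display) (Omega : measurableType dsp)
          (P : probability Omega R) (d : nat -> Omega -> digit k b),
     iid_uniform_digits P D d /\
     k%:R - k%:R / (k.+1)%:R < dim_l1 (fourier_abs P d)) ->
  let K := @missing_digit_fractal R k b D in
  let s := dimH K in
  exists eta : R, 0 < eta /\
    forall c : R, 0 < c ->
      exists Q0 C1 C2 : R, 1 <= Q0 /\ 0 < C1 /\ C1 <= C2 /\
        forall Q delta : R, Q0 <= Q -> 0 < delta < 1 ->
          c * Q `^ (- eta - k%:R^-1) <= delta ->
          C1 * delta `^ (k%:R - s) * Q `^ (s + 1) <= (count_N K Q delta)%:R /\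
          (count_N K Q delta)%:R <= C2 * delta `^ (k%:R - s) * Q `^ (s + 1).
Proof.
move=> b2 _ Kp [? [? [P [d [iid hdim]]]]] K s.
have k0 := proper_fractal_k_gt0 Kp; have D2 := proper_fractal_card_gt1 Kp.
have sE : s = simdim R D by exact: (dimH_missing_digit b2 D2 iid).
have [th [C [th0 th1 C0 HW]]] := dilated_sum_exponent k0 hdim.
have kR : 0 < k%:R :> R by rewrite ltr0n.
pose eta : R := (th^-1 - k.+1%:R / k%:R) / 2.
have eta0 : 0 < eta.
  rewrite divr_gt0 // subr_gt0 -[X in X < _]invrK invf_div ltf_pV2 ?posrE //.
  by rewrite divr_gt0.
have thE : th * (1 + k%:R^-1 + eta) = 1 - th * eta.
  rewrite /eta -[k.+1%:R]natr1; field; rewrite (gt_eqF kR) (gt_eqF th0) //.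
have te0 : 0 < th * eta by rewrite mulr_gt0.
exists eta; split => // c c0.
pose A : R := 10 * k%:R; have A0 : 0 < A by rewrite mulr_gt0.
pose E := C * (A / c) `^ th; pose eps : R := 4 ^- k / 32.
have E0 : 0 < E by rewrite mulr_gt0 // powR_gt0 // divr_gt0.
have eps0 : 0 < eps by rewrite divr_gt0 // invr_gt0 exprn_gt0.
pose C1 : R := (5 * k%:R) ^- k * 4 ^- k / 8 / ((4 * b).+1.*2.+1 ^ k)%:R.
pose C2 : R := 7 ^+ k * (cos (pi / 4) ^+ 4) ^- k * (4 * b%:R) `^ simdim R D * 64 ^+ k * 2.
(* Beyond this [Q0] the error [E Q^(1 - th eta)] is at most [eps Q]. The maximum with [C1] secures
   [C1 <= C2]. *)
exists (Num.max 1 ((E / eps) `^ (th * eta)^-1)), C1, (Num.max C1 C2).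
split; first by rewrite le_max lexx.
split.
  have B0 : 0 < ((4 * b).+1.*2.+1 ^ k)%:R :> R by rewrite ltr0n expn_gt0.
  apply: divr_gt0 => //; apply: divr_gt0 => //.
  by apply: mulr_gt0; rewrite invr_gt0 exprn_gt0 // mulr_gt0.
split; first by rewrite le_max lexx.
move=> Q delta; rewrite ge_max => /andP[Q1 QE] d01 cd.
have Q0 : 0 < Q by apply: lt_le_trans Q1.
have EQ : E * Q `^ (1 - th * eta) <= eps * Q.
  have h : E / eps <= Q `^ (th * eta).
    have := powR_le (ltW te0) (powR_ge0 _ _) QE.
    by rewrite -powRrM mulVf ?gt_eqF // powRr1 // divr_ge0 // ltW.
  rewrite powRB ?(lt0r_neq0 Q0) ?implybT // powRr1 ?(ltW Q0) //.
  have q0 : 0 < Q `^ (th * eta) by rewrite powR_gt0.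
  rewrite mulrCA mulrC ler_pM2r // ler_pdivrMr // mulrC -ler_pdivrMr //.
have /andP[d0 _] := d01.
have small N : (0 < N)%N -> N%:R <= 10 * k%:R / delta ->
     dilated_sum (fourier_abs P d) (Num.truncn Q) N <= 4 ^- k / 32 * Q.
  move=> N0 NA; apply: le_trans EQ; rewrite -thE.
  exact: (dilated_sum_small th0 C0 c0 A0 HW Q1 d0 cd N0 NA).
have [h1 h2] := counting_from_small_error b2 D2 k0 iid Q1 d01 small.
rewrite -/C1 mulrA in h1; rewrite -/C2 in h2.
rewrite sE; split; first exact: h1.
rewrite -mulrA; apply: le_trans h2 _; rewrite ler_wpM2r ?mulr_ge0 ?powR_ge0 //.
by rewrite le_max lexx orbT.
Qed.
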